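(* Let a network size $n \in \mathbb{N}$ and an edge probability $p \in (0,1)$ be given, let $\delta = 1/n$, and let $z(0) \in \mathbb{R}^n$ be given. Let $L_0, L_1, L_2, \ldots$ be the Laplacians of independent Erdős–Rényi random graphs $G_0, G_1, G_2, \ldots \in \mathcal{G}(n,p)$, and let $z(k)$ be generated by $z(k+1) = e^{-\delta L_k} z(k)$ for $k \ge 0$. Let $\hat{z}(k) = \left(I - \frac{1}{n}J\right) z(k)$. Define $$\kappa_1 = p,$$ $$\kappa_2 = (n-2)p^2 + 2p,$$ $$\kappa_3 = (n-2)(n-4)p^3 + 6(n-2)p^2 + 4p,$$ $$\kappa_4 = (n-7)(n-3)(n-2)p^4 + 6(2n-7)(n-2)p^3 + 25(n-2)p^2 + 8p,$$ $$\mu(n,p) = -2\frac{\kappa_1}{n} + 2\frac{\kappa_2}{n^2} - \frac{4}{3}\frac{\kappa_3}{n^3} + \frac{2}{3}\frac{\kappa_4}{n^4}.$$ Then for every $\gamma > 0$ and every $N \in \mathbb{N}$, $$\mathbb{P}\left[\sup_{N \leq k < \infty} \|\hat{z}(k)\|_2^2 \geq \gamma\right] \leq \frac{\hat{z}(0)^T\hat{z}(0)}{\gamma}\big(1 + n\mu(n,p)\big)^N.$$ In addition, with $V(z) = \frac{1}{n} z^T \hat{L} z$, where $\hat{L} = nI - J$, the expected decrease in $V$ from time $k$ to time $k+1$ satisfies, for every $k$, $$\mathbb{E}\big[V(\hat{z}(k+1)) - V(\hat{z}(k)) \mid \hat{z}(k)\big] \leq n\mu(n,p)\,\|\hat{z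}(k)\|_2^2.$$
   Context: $I$ is the $n \times n$ identity matrix and $J$ is the $n \times n$ matrix of all ones. $\mathcal{G}(n,p)$ denotes the Erdős–Rényi model: undirected, unweighted simple graphs (no self loops) on vertex set $\{1,\ldots,n\}$ in which each possible edge $\{i,j\}$, $i \neq j$, is present with probability $p$, independently of all other edges. The Laplacian of a graph $G$ is $L(G) = D(G) - A(G)$, where $A(G)$ is the symmetric $0/1$ adjacency matrix and $D(G)$ is the diagonal matrix of vertex degrees. A new random graph is generated at each timestep $k$. The iteration $z(k+1) = e^{-\delta L_k}z(k)$ is the time-sampled version of the continuous-time consensus protocol $\dot{x} = -Lx$, with $z(k) = x(k\delta)$ and communication graph $G_k$ constant on $[k\delta,(k+1)\delta)$. The initial state $z(0)$ is deterministic. The vector $\hat{z}(k)$ is the Euclidean projection of $z(k)$ onto the orthogonal complement of $\mathrm{span}\{(1,\ldots,1)^T\}$. $e^{M}$ denotes the matrix exponential. The conditional-expectation inequality is understood almost surely. *)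

(* Defs.v *)
From HB Require Import structures.
From mathcomp Require Export all_boot all_order all_algebra.
From mathcomp Require Export finmap.
From mathcomp Require Export all_classical all_reals all_analysis.
Export Order.TTheory GRing.Theory Num.Theory.
Export numFieldNormedType.Exports.

Set Implicit Arguments.
Unset Strict Implicit.
Unset Printing Implicit Defensive.

#[global] Open Scope classical_set_scope.
#[global] Open Scope ring_scope.

(* An edge is an unordered pair of distinct vertices, i.e. a 2-element set of
   vertices; a simple graph on 'I_n is its set of edges. *)
Definition is_edge (n : nat) (e : {set 'I_n}) : bool := #|e| == 2%N.

Definition simple_graph (n : nat) : Type :=
  {E : {set {set 'I_n}} | E \subset [set e | is_edge e]%SET}.

Definition edges (n : nat) (G : simple_graph n) : {set {set 'I_n}} := sval G.

(* For i = j the set [set i; j] is a singleton, hence never an edge. *)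
Definition adjacent (n : nat) (G : simple_graph n) (i j : 'I_n) : bool :=
  [set i; j]%SET \in edges G.

Definition vertex_degree (n : nat) (G : simple_graph n) (i : 'I_n) : nat :=
  #|[set j | adjacent G i j]%SET|.

Definition adjacency_mx (R : realType) (n : nat) (G : simple_graph n) : 'M[R]_n :=
  \matrix_(i, j) (adjacent G i j)%:R.

Definition degree_mx (R : realType) (n : nat) (G : simple_graph n) : 'M[R]_n :=
  diag_mx (\row_i (vertex_degree G i)%:R).

Definition laplacian (R : realType) (n : nat) (G : simple_graph n) : 'M[R]_n :=
  degree_mx R G - adjacency_mx R G.

Definition expm (R : realType) (n : nat) (A : 'M[R]_n) : 'M[R]_n :=
  limn (series (fun k : nat => (k`!%:R : R)^-1 *: A ^+ k)).

Definition ones_mx (R : realType) (n : nat) : 'M[R]_n := const_mx 1.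

Definition centered (R : realType) (n : nat) (z : 'cV[R]_n) : 'cV[R]_n :=
  (1%:M - n%:R^-1 *: ones_mx R n) *m z.

(* The norm `|_| on matrices in the library is the sup norm. *)
Definition norm2 (R : realType) (n : nat) (z : 'cV[R]_n) : R :=
  Num.sqrt (\sum_i z i ord0 ^+ 2).

Definition Lhat (R : realType) (n : nat) : 'M[R]_n := n%:R%:M - ones_mx R n.

Definition lyapunov (R : realType) (n : nat) (z : 'cV[R]_n) : R :=
  n%:R^-1 * (z^T *m Lhat R n *m z) ord0 ord0.

(* Mutual independence of the classes of events F i, for i ranging over D:
   the product rule holds over every finite subfamily of D. *)
Definition mutually_independent (d : measure_display) (T : measurableType d)
    (R : realType) (P : probability T R) (I : choiceType) (D : set I)
    (F : I -> set (set T)) : Prop :=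
  (forall i, D i -> F i `<=` measurable) /\
  (forall (J : {fset I}) (A : I -> set T),
     [set` J] `<=` D -> (forall i, i \in J -> F i (A i)) ->
     P (\bigcap_(i in [set` J]) A i) = (\prod_(i <- J) P (A i))%E).

Definition edge_event (T : Type) (n : nat) (G : T -> simple_graph n)
    (e : {set 'I_n}) : set T := [set w | e \in edges (G w)].

(* G has the Erdos-Renyi law G(n,p). *)
Definition erdos_renyi (d : measure_display) (T : measurableType d)
    (R : realType) (P : probability T R) (n : nat) (p : R)
    (G : T -> simple_graph n) : Prop :=
  (forall e : {set 'I_n}, is_edge e -> P (edge_event G e) = p%:E) /\
  mutually_independent P [set e : {set 'I_n} | is_edge e]
    (fun e => [set edge_event G e]).

(* Independence of random elements with values in the finite set of simple
   graphs, all of whose subsets are measurable. *)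
Definition independent_graphs (d : measure_display) (T : measurableType d)
    (R : realType) (P : probability T R) (n : nat)
    (G : nat -> T -> simple_graph n) : Prop :=
  mutually_independent P [set: nat]
    (fun k => preimage_set_system setT (G k) [set: set (simple_graph n)]).

(* sigma(X), for X a random vector: preimages of the Borel sets. *)
Definition sigma_of (T : Type) (R : realType) (n : nat) (X : T -> 'cV[R]_n) :
    set (set T) :=
  preimage_set_system setT X <<s [set U : set 'cV[R]_n | open U] >>.

(* Y is a version of the conditional expectation of X given the
   sub-sigma-algebra F. *)
Definition is_cond_exp (d : measure_display) (T : measurableType d)
    (R : realType) (P : probability T R) (F : set (set T)) (X Y : T -> R) : Prop :=
  [/\ P.-integrable setT (EFin \o X),
      forall B : set R, measurable B -> F (Y @^-1` B),
      P.-integrable setT (EFin \o Y) &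
      forall A, F A ->
        (\int[P]_(w in A) (Y w)%:E = \int[P]_(w in A) (X w)%:E)%E].

Definition kappa1 (R : realType) (p : R) : R := p.

Definition kappa2 (R : realType) (n : nat) (p : R) : R :=
  (n%:R - 2) * p ^+ 2 + 2 * p.

Definition kappa3 (R : realType) (n : nat) (p : R) : R :=
  (n%:R - 2) * (n%:R - 4) * p ^+ 3 + 6 * (n%:R - 2) * p ^+ 2 + 4 * p.

Definition kappa4 (R : realType) (n : nat) (p : R) : R :=
  (n%:R - 7) * (n%:R - 3) * (n%:R - 2) * p ^+ 4
  + 6 * (2 * n%:R - 7) * (n%:R - 2) * p ^+ 3
  + 25 * (n%:R - 2) * p ^+ 2 + 8 * p.

Definition mu (R : realType) (n : nat) (p : R) : R :=
  - 2 * (kappa1 p / n%:R) + 2 * (kappa2 n p / n%:R ^+ 2)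
  - 4 / 3 * (kappa3 n p / n%:R ^+ 3) + 2 / 3 * (kappa4 n p / n%:R ^+ 4).

(* Main.v *)
Require Import Defs.
From HB Require Import structures.
From mathcomp Require Import complex ring lra.

(* Let L be the Laplacian of G_k and t = 1/n. By the spectral theorem the numbers
   z^T L^m z are the moments of a nonnegative measure on [0, oo), and |e^(-tL) z|^2
   is the integral of e^(-2 t x) against it; hence it decreases in t and is at most
   the integral of the fourth Taylor polynomial of e^(-2 t x).
   On vectors z orthogonal to the ones vector, with x_e = e_i - e_j for an edge
   e = {i, j}, L acts as p n + M where M = sum_e b_e x_e x_e^T and the b_e are the
   independent centered edge indicators. So E[z^T L^m z] for m <= 4 follows from
   E[z^T M^m z], where only the terms in which every edge is repeated survive;
   sum_e x_e x_e^T = n I - J and (x_e . x_f)^3 = x_e . x_f for e <> f evaluate them,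
   giving E[z^T L^m z] = n kappa_m |z|^2.
   Finally |zhat(k)| is nonincreasing along every path, so the supremum over k >= N
   is attained at N and Markov's inequality suffices; and zhat(k) takes finitely many
   values, so conditioning on it is averaging over atoms. *)

Set Implicit Arguments.
Unset Strict Implicit.
Unset Printing Implicit Defensive.

(** * Moments of a symmetric positive semidefinite matrix *)

(** For w = a + ib the cross terms between a and b are purely imaginary because [L] is real, so the
    real part splits into the values of the form at a and at b. *)
Lemma complex_quad_form_ge0 (R : rcfType) (n : nat) (L : 'M[R]_n) (w : 'cV[R[i]]_n) :
  L^T = L -> (forall v : 'cV[R]_n, 0 <= (v^T *m L *m v) ord0 ord0) ->
  0 <= Re (((map_mx (@Num.conj _) w)^T *m map_mx (real_complex R) L *m w) ord0 ord0).
Proof.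
move=> Lsym Lpsd.
have -> : ((map_mx (@Num.conj _) w)^T *m map_mx (real_complex R) L *m w) ord0 ord0 =
  \sum_j \sum_k Num.conj (w k ord0) * real_complex R (L k j) * w j ord0.
  rewrite mxE; apply: eq_bigr => j _; rewrite mxE big_distrl /=.
  by apply: eq_bigr => k _; rewrite !mxE.
have quadE (v : 'cV[R]_n) : (v^T *m L *m v) ord0 ord0 =
    \sum_j \sum_k v k ord0 * L k j * v j ord0.
  rewrite mxE; apply: eq_bigr => j _; rewrite mxE big_distrl /=.
  by apply: eq_bigr => k _; rewrite !mxE.
rewrite (raddf_sum (@Re R : Rcomplex R -> R)) /=.
have -> : \sum_j Re (\sum_k (w k ord0)^* * real_complex R (L k j) * w j ord0) =
    ((map_mx (@Re R) w)^T *m L *m map_mx (@Re R) w) ord0 ord0 +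
    ((map_mx (@Im R) w)^T *m L *m map_mx (@Im R) w) ord0 ord0.
  rewrite !quadE -big_split; apply: eq_bigr => j _ /=.
  rewrite (raddf_sum (@Re R : Rcomplex R -> R)) -big_split; apply: eq_bigr => k _ /=.
  rewrite !mxE; case: (w k ord0) => a b; case: (w j ord0) => c e /=; ring.
by rewrite addr_ge0.
Qed.

Lemma expmxS (R : pzRingType) (n : nat) (A : 'M[R]_n) m : A ^+ m.+1 = A *m A ^+ m.
Proof. exact: exprS. Qed.

(** The spectral theorem is applied to [L] viewed over [R[i]]: [c i] is the squared modulus of the
    i-th coordinate of [z] in an orthonormal eigenbasis, and [lam i] is the i-th eigenvalue. *)
Lemma sym_psd_moments (R : rcfType) (n : nat) (L : 'M[R]_n) (z : 'cV[R]_n) :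
  L^T = L -> (forall v : 'cV[R]_n, 0 <= (v^T *m L *m v) ord0 ord0) ->
  exists c : 'I_n -> R, exists lam : 'I_n -> R,
    [/\ forall i, 0 <= c i, forall i, 0 <= lam i &
        forall m, (z^T *m L ^+ m *m z) ord0 ord0 = \sum_i c i * lam i ^+ m].
Proof.
move=> Lsym Lpsd.
(* [A], [V] and [u] are kept opaque: rewriting diverges when they can be unfolded. *)
have [A AE] : exists A, A = map_mx (real_complex R) L by eexists.
have conjr (x : R) : (real_complex R x)^* = real_complex R x.
  by apply/CrealP/complex_realP; exists x.
have Aherm : A \is hermsymmx.
  apply/is_hermitianmxP; rewrite expr0 scale1r AE -{1}Lsym.
  by apply/matrixP => i j; rewrite !mxE conjr.
have [U [V [D [[UV VU] VE Aspec Dreal]]]] : exists U V, exists D : 'rV[R[i]]_n,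
    [/\ U *m V = 1%:M /\ V *m U = 1%:M, V = map_mx (@Num.conj _) U^T,
      A = V *m diag_mx D *m U & forall i, D ord0 i = real_complex R (Re (D ord0 i))].
  exists (spectralmx A), (invmx (spectralmx A)), (spectral_diag A); split.
  - by rewrite mulmxV ?mulVmx ?spectral_unit.
  - by rewrite invmx_unitary ?spectral_unitarymx.
  - exact/orthomx_spectralP/hermitian_normalmx.
  - move=> i; rewrite RRe_real //.
    by have /mxOverP := hermitian_spectral_diag_real Aherm; exact.
have conj_mul (X Y : 'M[R[i]]_n) : V *m X *m U *m (V *m Y *m U) = V *m (X *m Y) *m U.
  by rewrite -!mulmxA (mulmxA U) UV mul1mx.
have [u uE] : exists u, u = U *m map_mx (real_complex R) z by eexists.
exists (fun i => Re (u i ord0) ^+ 2 + Im (u i ord0) ^+ 2), (fun i => Re (D ord0 i)).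
split=> [i|i|m].
- by rewrite addr_ge0 ?sqr_ge0.
(* An eigenvalue is the value of the Hermitian form at its unit eigenvector, here the i-th column of
   [V], hence nonnegative. *)
- pose w := col i V.
  have -> : D ord0 i = ((map_mx (@Num.conj _) w)^T *m A *m w) ord0 ord0.
    have -> : (map_mx (@Num.conj _) w)^T = row i U.
      by apply/matrixP => a b; rewrite /w VE !mxE conjCK.
    rewrite /w Aspec colE rowE !mulmxA -(mulmxA _ U V) UV mulmx1.
    rewrite -(mulmxA _ U V) UV mulmx1.
    by rewrite -rowE -colE !mxE eqxx mulr1n.
  rewrite AE; exact: complex_quad_form_ge0.
- have Am : map_mx (real_complex R) (L ^+ m) = A ^+ m.
    rewrite AE; elim: m => [|m IH]; first by rewrite !expr0 map_mx1.
    by rewrite !expmxS -IH -map_mxM.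
  have Asp : A ^+ m = V *m diag_mx (\row_i (D ord0 i ^+ m)) *m U.
    elim: m {Am} => [|m IH].
      rewrite expr0; have -> : \row_i (D ord0 i ^+ 0) = const_mx 1.
        by apply/rowP => i; rewrite !mxE expr0.
      by rewrite diag_const_mx mulmx1 VU.
    rewrite expmxS IH [X in X *m _]Aspec conj_mul; apply: (congr1 (fun X => V *m X *m U)).
    by rewrite mulmx_diag; apply: (congr1 diag_mx); apply/rowP => i; rewrite !mxE exprS.
  apply: (@complexI R).
  have -> : real_complex R ((z^T *m L ^+ m *m z) ord0 ord0) =
      (map_mx (real_complex R) (z^T *m L ^+ m *m z)) ord0 ord0 by rewrite !mxE.
  rewrite !map_mxM Am Asp.
  have -> : map_mx (real_complex R) z^T *m
      (V *m diag_mx (\row_i D ord0 i ^+ m) *m U) *m map_mx (real_complex R) z =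
      (map_mx (@Num.conj _) u)^T *m diag_mx (\row_i D ord0 i ^+ m) *m u.
    have -> : (map_mx (@Num.conj _) u)^T = map_mx (real_complex R) z^T *m V.
      rewrite uE map_mxM trmx_mul VE; congr (_ *m _).
        apply/matrixP => a b; rewrite !mxE; exact: conjr.
      exact: map_trmx.
    by rewrite uE !mulmxA.
  rewrite mul_mx_diag mxE rmorph_sum; apply: eq_bigr => i _.
  rewrite !mxE rmorphM rmorphXn /= -Dreal mulrAC; congr (_ * _).
  case: (u i ord0) => a b; rewrite /=; simpc; congr (_ +i* _)%C; ring.
Qed.

(** * The matrix exponential *)

(* The library declares completeness of matrices before their norm, so the join
   completeNormedModType is only created by this redeclaration. *)
HB.instance Definition _ (R : realType) (m n : nat) :=
  Uniform_isComplete.Build 'M[R]_(m, n) cauchy_cvg.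

(** The norm is the largest modulus of an entry, and an entry of the product is a sum over the inner
    dimension; hence the factor [n]. *)
Lemma mx_norm_mul (R : realType) (m n p : nat) (A : 'M[R]_(m, n)) (B : 'M[R]_(n, p)) :
  `|A *m B| <= n%:R * `|A| * `|B|.
Proof.
have coord (a b : nat) (C : 'M[R]_(a, b)) i j : `|C i j| <= `|C|.
  rewrite [leRHS]/Num.norm/= mx_normrE; exact: (le_bigmax _ _ (i, j)).
rewrite [leLHS]/Num.norm/= mx_normrE; apply: bigmax_le => [|[i j] _] /=.
  by rewrite !mulr_ge0.
rewrite mxE (le_trans (ler_norm_sum _ _ _)) //.
have -> : n%:R * `|A| * `|B| = \sum_(k < n) (`|A| * `|B|).
  by rewrite sumr_const card_ord -mulrA mulr_natl.
apply: ler_sum => k _.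
by rewrite normrM ler_pM.
Qed.

(** [expm] is a [limn], which is meaningful only once convergence is known. Convergence is absolute:
    powers of [A] grow at most like those of r = n |A|, so the scalar exponential series at r
    dominates. *)
Lemma expm_cvg (R : realType) (n : nat) (A : 'M[R]_n) :
  series (fun k : nat => (k`!%:R : R)^-1 *: A ^+ k) @ \oo --> expm A.
Proof.
suff: cvgn (series (fun k : nat => (k`!%:R : R)^-1 *: A ^+ k)) by [].
apply: normed_cvg.
pose r := n%:R * `|A|.
have r0 : 0 <= r by rewrite mulr_ge0.
have bnd k : `|A ^+ k| <= `|(1%:M : 'M[R]_n)| * r ^+ k.
  elim: k => [|k IH]; first by rewrite !expr0 mulr1.
  rewrite expmxS (le_trans (mx_norm_mul _ _)) // -/r exprS mulrCA.
  by rewrite ler_wpM2l.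
apply: (@series_le_cvg _ _ (`|(1%:M : 'M[R]_n)| *: exp_coeff r)) => [k|k|k|].
- exact: normr_ge0.
- by rewrite /= mulr_ge0 // exp_coeff_ge0.
- rewrite /= normrZ ger0_norm ?invr_ge0 // mulrC.
  have -> : (`|(1%:M : 'M[R]_n)| *: exp_coeff r) k =
    `|(1%:M : 'M[R]_n)| * r ^+ k / k`!%:R by rewrite -mulrA.
  by rewrite ler_wpM2r ?invr_ge0.
- apply: is_cvg_seriesZ; exact: is_cvg_series_exp_coeff.
Qed.

(** With q the Taylor polynomial on the right, [expR t * q t] equals 1 at 0 and is nondecreasing, so
    it is at least 1 at [x]. *)
Lemma expRN_le_taylor4 (R : realType) (x : R) : 0 <= x ->
  expR (- x) <= 1 - x + x ^+ 2 / 2 - x ^+ 3 / 6 + x ^+ 4 / 24.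
Proof.
move=> x0.
pose q (t : R) := 1 - t + t ^+ 2 / 2 - t ^+ 3 / 6 + t ^+ 4 / 24.
(* The derivative of [expR t * q t] is [expR t * t ^+ 4 / 24]. *)
pose g (t : R) := expR t * q t.
have dg (t : R) : is_derive t 1 g (expR t * (t ^+ 4 / 24)).
  rewrite /g /q; apply: is_derive_eq.
  by rewrite /GRing.scale /=; field.
have : g 0 <= g x.
  apply: (@ger0_derive1_le_cc _ g 0 x) => //.
  - by move=> t _; rewrite derive1E derive_val mulr_ge0 ?expR_ge0 // divr_ge0 // exprn_even_ge0.
  - apply: derivable_within_continuous => t _; exact: ex_derive.
  - by rewrite in_itv /= lexx x0.
  - by rewrite in_itv /= lexx x0.
rewrite {1}/g expR0 mul1r {1}/q; set l := (X in X <= _).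
have -> : l = 1 by rewrite /l; field.
rewrite /g expRN -ler_pdivrMl ?expR_gt0 // mulr1; exact.
Qed.

Lemma cvgn_sum (R : realType) (I : finType) (f : I -> nat -> R) (l : I -> R) :
  (forall i, f i k @[k --> \oo] --> l i) ->
  \sum_i f i k @[k --> \oo] --> \sum_i l i.
Proof. by move=> fl; apply: cvg_big => //; exact: add_continuous. Qed.

Lemma cvgn_mulmx_entry (R : realType) (m n p q : nat) (C : 'M[R]_(q, m))
    (M : nat -> 'M[R]_(m, n)) (A : 'M[R]_(m, n)) (B : 'M[R]_(n, p)) i j :
  M @ \oo --> A -> (C *m M k *m B) i j @[k --> \oo] --> (C *m A *m B) i j.
Proof.
move=> MA.
have ent a b : M k a b @[k --> \oo] --> A a b.
  apply: (@continuous_cvg _ _ _ _ _ M (fun X : 'M[R]_(m, n) => X a b) A) => //.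
  exact: coord_continuous.
rewrite (_ : (fun k => _) = fun k => \sum_a \sum_b C i b * M k b a * B a j).
  rewrite (_ : _ i j = \sum_a \sum_b C i b * A b a * B a j); last first.
    by rewrite mxE; apply: eq_bigr => a _; rewrite mxE mulr_suml.
  apply: cvgn_sum => a; apply: cvgn_sum => b.
  by apply: cvgMl; apply: cvgMr; exact: ent.
apply/funext => k; rewrite mxE; apply: eq_bigr => a _.
by rewrite mxE mulr_suml.
Qed.

Lemma scalemx_exp (R : comPzRingType) (n : nat) (a : R) (A : 'M[R]_n) m :
  (a *: A) ^+ m = a ^+ m *: A ^+ m.
Proof.
elim: m => [|m IH]; first by rewrite !expr0 scale1r.
by rewrite !expmxS IH -scalemxAl -scalemxAr scalerA exprS.
Qed.

(** [B] commutes with every partial sum of the series, and the identity passes to the limit entry by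
    entry. *)
Lemma expm_comm (R : realType) (n : nat) (A B : 'M[R]_n) :
  A *m B = B *m A -> expm A *m B = B *m expm A.
Proof.
move=> AB; apply/matrixP => i j.
have comm k : A ^+ k *m B = B *m A ^+ k.
  elim: k => [|k IH]; first by rewrite !expr0 mul1mx mulmx1.
  by rewrite expmxS -mulmxA IH !mulmxA AB.
have h1 := @cvgn_mulmx_entry R n n n n 1%:M _ _ B i j (@expm_cvg R n A).
have h2 := @cvgn_mulmx_entry R n n n n B _ _ 1%:M i j (@expm_cvg R n A).
rewrite mul1mx in h1; rewrite mulmx1 in h2.
apply: (cvg_unique _ h1); rewrite //.
rewrite (_ : (fun k => _) = fun k =>
  (B *m series (fun k : nat => (k`!%:R : R)^-1 *: A ^+ k) k *m 1%:M) i j) //.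
apply/funext => k; rewrite mul1mx mulmx1; congr (fun_of_matrix _ i j).
rewrite /series /= mulmx_suml mulmx_sumr; apply: eq_bigr => l _.
by rewrite -scalemxAl -scalemxAr comm.
Qed.

(** * The norm of e^(-tL) z in terms of the moments of z *)

Lemma norm2_sqr (R : realType) (n : nat) (z : 'cV[R]_n) :
  norm2 z ^+ 2 = (z^T *m z) ord0 ord0.
Proof.
rewrite sqr_sqrtr ?sumr_ge0 // => [|i _]; last exact: sqr_ge0.
by rewrite mxE; apply: eq_bigr => i _; rewrite mxE expr2.
Qed.

Lemma expmx_sym (R : comPzRingType) (n : nat) (L : 'M[R]_n) m :
  L^T = L -> (L ^+ m)^T = L ^+ m.
Proof.
move=> Ls; elim: m => [|m IH]; first by rewrite expr0 trmx1.
rewrite expmxS trmx_mul IH Ls; elim: m {IH} => [|m IH]; first by rewrite expr0 mul1mx mulmx1.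
by rewrite expmxS -mulmxA IH.
Qed.

Lemma expmxD (R : pzRingType) (n : nat) (A : 'M[R]_n) k l :
  A ^+ (k + l) = A ^+ k *m A ^+ l.
Proof. exact: exprD. Qed.

(** For a partial sum S of the series, symmetry of [L] turns |S z|^2 into a double sum of moments
    z^T L^(l+m) z. For each i it factors into the square of a scalar exponential partial sum; then
    both sides pass to the limit. *)
Lemma norm2_expmN (R : realType) (n : nat) (L : 'M[R]_n) (t : R) (z : 'cV[R]_n)
    (c lam : 'I_n -> R) :
  L^T = L ->
  (forall m, (z^T *m L ^+ m *m z) ord0 ord0 = \sum_i c i * lam i ^+ m) ->
  norm2 (expm (- (t *: L)) *m z) ^+ 2 = \sum_i c i * expR (- (t * lam i)) ^+ 2.
Proof.
move=> Lsym mom; rewrite norm2_sqr.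
pose S := series (fun k : nat => (k`!%:R : R)^-1 *: (- (t *: L)) ^+ k).
pose a k : R := (k`!%:R)^-1 * (- t) ^+ k.
have SE k : S k = \sum_(0 <= l < k) a l *: L ^+ l.
  rewrite /S /series /=; apply: eq_bigr => l _.
  by rewrite -scaleNr scalemx_exp scalerA.
have quadS k : ((S k *m z)^T *m (S k *m z)) ord0 ord0 =
    \sum_i c i * (series (exp_coeff (- (t * lam i))) k) ^+ 2.
  have -> : (S k *m z)^T *m (S k *m z) =
      \sum_(0 <= l < k) \sum_(0 <= m < k) (a l * a m) *: (z^T *m L ^+ (l + m) *m z).
    rewrite SE trmx_mul linear_sum /= -mulmxA mulmx_suml mulmx_sumr.
    apply: eq_bigr => l _; rewrite linearZ /= expmx_sym // mulmxA.
    rewrite mulmx_suml mulmx_sumr; apply: eq_bigr => m _.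
    rewrite !(=^~ scalemxAl, =^~ scalemxAr) scalerA expmxD !mulmxA.
    by rewrite mulrC.
  rewrite summxE.
  under eq_bigr => l _ do rewrite summxE.
  under eq_bigr => l _ do under eq_bigr => m _ do rewrite mxE mom mulr_sumr.
  under eq_bigr => l _ do rewrite exchange_big /=.
  rewrite exchange_big /=; apply: eq_bigr => i _.
  rewrite expr2 /series /= mulr_suml mulr_sumr; apply: eq_bigr => l _.
  rewrite !mulr_sumr; apply: eq_bigr => m _.
  rewrite /a /exp_coeff /= -mulNr !exprMn exprD; ring.
have ent i : (S k *m z) i ord0 @[k --> \oo] --> (expm (- (t *: L)) *m z) i ord0.
  have := @cvgn_mulmx_entry R n n 1 n 1%:M _ _ z i ord0 (@expm_cvg R n (- (t *: L))).
  by under eq_cvg do rewrite mul1mx; rewrite mul1mx.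
have lim1 : ((S k *m z)^T *m (S k *m z)) ord0 ord0 @[k --> \oo] -->
    ((expm (- (t *: L)) *m z)^T *m (expm (- (t *: L)) *m z)) ord0 ord0.
  under eq_cvg do rewrite mxE; rewrite mxE.
  apply: cvgn_sum => i; under eq_cvg do rewrite mxE; rewrite mxE.
  by apply: cvgM; exact: ent.
apply: (cvg_unique _ lim1); first exact: norm_hausdorff.
rewrite /=; under eq_cvg do rewrite quadS.
apply: cvgn_sum => i; apply: cvgMr; rewrite expr2.
under eq_cvg do rewrite expr2.
by apply: cvgM; exact: is_cvg_series_exp_coeff.
Qed.

Lemma norm2_expmN_le (R : realType) (n : nat) (L : 'M[R]_n) (t : R) (z : 'cV[R]_n) :
  L^T = L -> (forall v : 'cV[R]_n, 0 <= (v^T *m L *m v) ord0 ord0) -> 0 <= t ->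
  norm2 (expm (- (t *: L)) *m z) ^+ 2 <= norm2 z ^+ 2.
Proof.
move=> Lsym Lpsd t0; have [c [lam [c0 lam0 mom]]] := sym_psd_moments z Lsym Lpsd.
rewrite (norm2_expmN _ Lsym mom).
have := mom 0%N; rewrite expr0 mulmx1 -norm2_sqr => ->.
apply: ler_sum => i _; rewrite ler_wpM2l // expr0 expr_le1 ?expR_ge0 //.
by rewrite expR_le1 oppr_le0 mulr_ge0.
Qed.

Lemma norm2_expmN_le_taylor4 (R : realType) (n : nat) (L : 'M[R]_n) (t : R) (z : 'cV[R]_n) :
  L^T = L -> (forall v : 'cV[R]_n, 0 <= (v^T *m L *m v) ord0 ord0) -> 0 <= t ->
  let q m := (z^T *m L ^+ m *m z) ord0 ord0 in
  norm2 (expm (- (t *: L)) *m z) ^+ 2 <=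
    q 0%N - 2 * t * q 1%N + 2 * t ^+ 2 * q 2%N - 4 / 3 * t ^+ 3 * q 3%N
    + 2 / 3 * t ^+ 4 * q 4%N.
Proof.
move=> Lsym Lpsd t0 /=; have [c [lam [c0 lam0 mom]]] := sym_psd_moments z Lsym Lpsd.
rewrite (norm2_expmN _ Lsym mom) !mom !mulr_sumr -!sumrN -!big_split /=.
apply: ler_sum => i _; rewrite expr0 expr1.
(* The squared exponential at t lam is one exponential at 2 t lam, so the Taylor coefficients 2^m /
   m! are 2, 2, 4/3 and 2/3. *)
have := @expRN_le_taylor4 R (2 * (t * lam i)); rewrite !mulr_ge0 // => /(_ isT).
rewrite -mulrN expRM_natl => /(ler_wpM2l (c0 i)) /le_trans; apply.
by rewrite le_eqVlt; apply/orP; left; apply/eqP; field.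
Qed.

(** * Centered independent edge indicators *)

Section Moments.
Context {R : realType} {H I : finType}.
Context (w : H -> R) (a : I -> H -> R) (p : R).

Definition mean (f : H -> R) : R := \sum_h w h * f h.

Lemma meanD f g : mean (fun h => f h + g h) = mean f + mean g.
Proof. by rewrite -big_split; apply: eq_bigr => h _; rewrite mulrDr. Qed.

Lemma meanZ c f : mean (fun h => c * f h) = c * mean f.
Proof. by rewrite mulr_sumr; apply: eq_bigr => h _; rewrite mulrCA. Qed.

Lemma mean_sum (J : finType) (f : J -> H -> R) :
  mean (fun h => \sum_j f j h) = \sum_j mean (f j).
Proof. by rewrite exchange_big; apply: eq_bigr => h _; rewrite mulr_sumr. Qed.

Lemma eq_mean f g : f =1 g -> mean f = mean g.
Proof. by move=> fg; apply: eq_bigr => h _; rewrite fg. Qed.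

Lemma mean_le f g : (forall h, 0 <= w h) -> (forall h, f h <= g h) -> mean f <= mean g.
Proof. by move=> w0 fg; apply: ler_sum => h _; rewrite ler_wpM2l. Qed.

(** This single identity encodes the law: the empty list gives total mass one, repeated indicators
    collapse, and distinct ones are independent with mean [p]. *)
Hypothesis meanE : forall s : seq I, mean (fun h => \prod_(e <- s) a e h) = p ^+ size (undup s).

Definition cent (e : I) (h : H) : R := a e h - p.
Definition kron (e f : I) : R := (e == f)%:R.
(** The second, third and fourth central moments of a Bernoulli variable of parameter [p]. *)
Let s2 := p * (1 - p).
Let s3 := s2 * (1 - 2 * p).
Let s4 := s2 * (1 - 3 * s2).

(** Here and in the next three lemmas the centered product is expanded into products of raw
    indicators, each of which [meanE] evaluates. *)
Lemma mean_cent e : mean (cent e) = 0.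
Proof.
rewrite (@eq_mean _ (fun h => \prod_(i <- [:: e]) a i h +
   - p * \prod_(i <- [::]) a i h)); last first.
  by move=> h; rewrite !big_cons !big_nil /cent; ring.
by rewrite meanD meanZ !meanE /= ; ring.
Qed.

Lemma mean_cent2 e f : mean (fun h => cent e h * cent f h) = kron e f * s2.
Proof.
rewrite (@eq_mean _ (fun h => \prod_(i <- [:: e; f]) a i h +
   (- p * \prod_(i <- [:: e]) a i h + (- p * \prod_(i <- [:: f]) a i h
   + p ^+ 2 * \prod_(i <- [::]) a i h)))); last first.
  by move=> h; rewrite !big_cons !big_nil /cent; ring.
rewrite !meanD !meanZ !meanE /= !inE /kron /s2.
by case: eqP => _ /=; ring.
Qed.

Lemma mean_cent3 e f g : mean (fun h => cent e h * cent f h * cent g h) =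
  kron e f * kron f g * s3.
Proof.
rewrite (@eq_mean _ (fun h => \prod_(i <- [:: e; f; g]) a i h +
   (- p * \prod_(i <- [:: e; f]) a i h + (- p * \prod_(i <- [:: f; g]) a i h
   + (- p * \prod_(i <- [:: e; g]) a i h
   + (p ^+ 2 * \prod_(i <- [:: e]) a i h
   + (p ^+ 2 * \prod_(i <- [:: f]) a i h
   + (p ^+ 2 * \prod_(i <- [:: g]) a i h
   + - p ^+ 3 * \prod_(i <- [::]) a i h)))))))); last first.
  by move=> h; rewrite !big_cons !big_nil /cent; ring.
rewrite !meanD !meanZ !meanE /= !inE /kron /s3 /s2.
have [?|ef] := eqVneq e f; have [?|fg] := eqVneq f g; try subst f; try subst g;
  rewrite ?eqxx ?(negbTE ef) ?(negbTE fg) /=; try ring.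
by have [?|eg] := eqVneq e g; rewrite /=; ring.
Qed.

(** Each of the three pairings of the four indices contributes [s2 ^+ 2]. When all indices agree the
    pairings give [3 * s2 ^+ 2], and the fourth cumulant [s4 - 3 * s2 ^+ 2] corrects this to
    [s4]. *)
Lemma mean_cent4 e f g k : mean (fun h => cent e h * cent f h * cent g h * cent k h) =
  s2 ^+ 2 * (kron e f * kron g k + kron e k * kron f g + kron e g * kron f k)
  + (s4 - 3 * s2 ^+ 2) * (kron e f * kron f g * kron g k).
Proof.
pose P s h := \prod_(i <- s) a i h.
rewrite (@eq_mean _ (fun h => P [:: e; f; g; k] h +
   (- p * P [:: e; f; g] h + (- p * P [:: e; f; k] h
   + (- p * P [:: e; g; k] h + (- p * P [:: f; g; k] h
   + (p ^+ 2 * P [:: e; f] h + (p ^+ 2 * P [:: e; g] h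
   + (p ^+ 2 * P [:: e; k] h + (p ^+ 2 * P [:: f; g] h
   + (p ^+ 2 * P [:: f; k] h + (p ^+ 2 * P [:: g; k] h
   + (- p ^+ 3 * P [:: e] h + (- p ^+ 3 * P [:: f] h
   + (- p ^+ 3 * P [:: g] h + (- p ^+ 3 * P [:: k] h
   + p ^+ 4 * P [::] h)))))))))))))))); last first.
  by move=> h; rewrite /P !big_cons !big_nil /cent; ring.
rewrite !meanD !meanZ !meanE /= !inE /kron /s4 /s2.
(* All coincidence patterns are enumerated; inconsistent ones leave some x != x in the context. *)
have [?|ef] := eqVneq e f; have [?|fg] := eqVneq f g; have [?|gk] := eqVneq g k;
have [?|eg] := eqVneq e g; have [?|fk] := eqVneq f k; have [?|ek] := eqVneq e k;
  rewrite /=; try subst f; try subst g; try subst k; try ring;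
  by match goal with xx : is_true (?x != ?x) |- _ => rewrite eqxx in xx end.
Qed.
End Moments.

(** * Mean of the quadratic forms *)

Lemma sum_kron (R : realType) (I : finType) (e : I) (F : I -> R) :
  \sum_f kron e f * F f = F e.
Proof.
rewrite (bigD1 e) //= /kron eqxx mul1r big1 ?addr0 // => f fe.
by rewrite eq_sym (negbTE fe) mul0r.
Qed.

Section GramOperator.
Context {R : realType} {I : finType} (zeta : I -> R) (K : I -> I -> R) (N : R).

(** Edge coordinates: with [K] the Gram matrix of the vectors x_e, this is the action of sum_e c_e
    x_e x_e^T on the family of inner products x_e . v. *)
Definition gram_op (c xi : I -> R) : I -> R := fun e => \sum_f K e f * (c f * xi f).
Definition gram_form (c xi : I -> R) : R := \sum_e zeta e * (c e * xi e).

Lemma gram_opD c xi1 xi2 k1 k2 :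
  gram_op c (fun e => k1 * xi1 e + k2 * xi2 e) =
  fun e => k1 * gram_op c xi1 e + k2 * gram_op c xi2 e.
Proof.
apply/funext => e; rewrite /gram_op !mulr_sumr -big_split /=.
by apply: eq_bigr => f _; ring.
Qed.

Lemma gram_formD c xi1 xi2 k1 k2 :
  gram_form c (fun e => k1 * xi1 e + k2 * xi2 e) =
  k1 * gram_form c xi1 + k2 * gram_form c xi2.
Proof.
rewrite /gram_form !mulr_sumr -big_split /=.
by apply: eq_bigr => f _; ring.
Qed.

Hypothesis Ksym : forall e f, K e f = K f e.
Hypothesis Kzeta : forall e, \sum_f K e f * zeta f = N * zeta e.
Hypothesis KK : forall e g, \sum_f K e f * K f g = N * K e g.

Lemma gram_op_eigen c xi e : \sum_f K e f * gram_op c xi f = N * gram_op c xi e.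
Proof.
rewrite /gram_op; under eq_bigr do rewrite mulr_sumr.
rewrite exchange_big mulr_sumr; apply: eq_bigr => f _ /=.
rewrite [RHS]mulrA -KK mulr_suml; apply: eq_bigr => g _; ring.
Qed.

(* [K] acts as the scalar [N] on the image of [gram_op], so the constant part [p] of
   the coefficients contributes the scalar [p * N]. *)
Lemma gram_op_shift p c xi : (forall e, \sum_f K e f * xi f = N * xi e) ->
  gram_op (fun e => p + c e) xi = fun e => p * N * xi e + 1 * gram_op c xi e.
Proof.
move=> Kxi; apply/funext => e; rewrite -mulrA -Kxi /gram_op !mulr_sumr -big_split /=.
by apply: eq_bigr => f _; ring.
Qed.

Lemma gram_form_shift p c xi :
  gram_form (fun e => p + c e) xi = p * \sum_e zeta e * xi e + gram_form c xi.
Proof.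
rewrite /gram_form mulr_sumr -big_split /=; apply: eq_bigr => e _; ring.
Qed.

(** By symmetry [K] can be moved onto [zeta], where it acts as [N]. *)
Lemma zeta_gram_op c xi : \sum_e zeta e * gram_op c xi e = N * gram_form c xi.
Proof.
rewrite /gram_op /gram_form mulr_sumr; under eq_bigr do rewrite mulr_sumr.
rewrite exchange_big; apply: eq_bigr => f _ /=.
rewrite mulrA -Kzeta mulr_suml; apply: eq_bigr => e _; rewrite (Ksym f e); ring.
Qed.

(** With M = [gram_op c], N times [q m] is the binomial expansion of zeta^T (t + M)^(m+1) zeta, in
    which zeta^T M^(j+1) zeta = N r_j and zeta^T zeta = Z. *)
Lemma gram_form_expand (p : R) (c : I -> R) :
  let a e := p + c e in let Z := \sum_e zeta e ^+ 2 in
  let r m := gram_form c (iter m (gram_op c) zeta) in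
  let q m := gram_form a (iter m (gram_op a) zeta) in
  let t := p * N in
  [/\ q 0%N = p * Z + r 0%N,
      q 1%N = p * t * Z + 2 * t * r 0%N + r 1%N,
      q 2%N = p * t ^+ 2 * Z + 3 * t ^+ 2 * r 0%N + 3 * t * r 1%N + r 2%N &
      q 3%N = p * t ^+ 3 * Z + 4 * t ^+ 3 * r 0%N + 6 * t ^+ 2 * r 1%N
              + 4 * t * r 2%N + r 3%N].
Proof.
move=> a Z r q t.
pose v m := iter m (gram_op c) zeta.
(* Every iterate stays in the eigenspace of [K] for [N], so the shift by [t] applies at each
   stage. *)
have veig m e : \sum_f K e f * v m f = N * v m e.
  by case: m => [|m]; [exact: Kzeta | exact: gram_op_eigen].
have opv m : gram_op a (v m) = fun e => t * v m e + 1 * v m.+1 e.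
  by rewrite /a gram_op_shift.
have zv0 : \sum_e zeta e * v 0%N e = Z by apply: eq_bigr => e _; rewrite expr2.
have zv m : \sum_e zeta e * v m.+1 e = N * r m by exact: zeta_gram_op.
have fv0 : gram_form a (v 0%N) = p * Z + r 0%N by rewrite /a gram_form_shift zv0.
have fv m : gram_form a (v m.+1) = t * r m + r m.+1.
  transitivity (p * (N * r m) + r m.+1); first by rewrite /a gram_form_shift zv.
  by rewrite /t; ring.
have u1 : iter 1 (gram_op a) zeta = fun e => t * v 0%N e + 1 * v 1%N e by exact: (opv 0%N).
have u2 : iter 2 (gram_op a) zeta =
    fun e => t * (t * v 0%N e + 1 * v 1%N e) + 1 * (t * v 1%N e + 1 * v 2%N e).
  by rewrite iterS u1 gram_opD !opv.
have u3 : iter 3 (gram_op a) zeta =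
    fun e => t * (t * (t * v 0%N e + 1 * v 1%N e) + 1 * (t * v 1%N e + 1 * v 2%N e))
      + 1 * (t * (t * v 1%N e + 1 * v 2%N e) + 1 * (t * v 2%N e + 1 * v 3%N e)).
  by rewrite iterS u2 !gram_opD !opv.
split; rewrite /q ?u1 ?u2 ?u3 ?gram_formD ?fv ?fv0 //; ring.
Qed.

End GramOperator.

(** * Expected forms of degrees one to four *)

Section MeanGramForms.
Context {R : realType} {H I : finType}.
Context (w : H -> R) (a : I -> H -> R) (p : R).
Hypothesis meanE : forall s : seq I,
  mean w (fun h => \prod_(e <- s) a e h) = p ^+ size (undup s).
Context (zeta : I -> R) (K : I -> I -> R) (n : nat).
Hypothesis Ksym : forall e f, K e f = K f e.
Hypothesis Kdiag : forall e, K e e = 2.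
Hypothesis Kcube : forall e f, e != f -> K e f ^+ 3 = K e f.
Hypothesis Kzeta : forall e, \sum_f K e f * zeta f = n%:R * zeta e.
Hypothesis KK : forall e g, \sum_f K e f * K f g = n%:R * K e g.

Let c h e := cent a p e h.
Let r m h := gram_form zeta (c h) (iter m (gram_op K (c h)) zeta).
Let Z := \sum_e zeta e ^+ 2.
Let s2 := p * (1 - p).
Let s3 := s2 * (1 - 2 * p).
Let s4 := s2 * (1 - 3 * s2).

Lemma mean_gram_form0 : mean w (r 0%N) = 0.
Proof.
rewrite /r /gram_form mean_sum big1 // => e _ /=.
rewrite (@eq_mean _ _ _ _ (fun h => zeta e ^+ 2 * cent a p e h)).
  by rewrite meanZ mean_cent ?mulr0.
by move=> h; rewrite /c; ring.
Qed.

Lemma mean_gram_form1 : mean w (r 1%N) = 2 * s2 * Z.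
Proof.
rewrite /r /gram_form mean_sum mulr_sumr; apply: eq_bigr => e _ /=.
rewrite /gram_op.
rewrite (@eq_mean _ _ _ _ (fun h => \sum_f
   zeta e * K e f * zeta f * (cent a p e h * cent a p f h))); last first.
  by move=> h; rewrite /c !mulr_sumr; apply: eq_bigr => f _; ring.
rewrite mean_sum.
under eq_bigr do rewrite meanZ (mean_cent2 meanE) mulrCA.
by rewrite sum_kron Kdiag -/s2; ring.
Qed.

Lemma mean_gram_form2 : mean w (r 2%N) = 4 * s3 * Z.
Proof.
rewrite /r /gram_form mean_sum mulr_sumr; apply: eq_bigr => e _ /=.
rewrite /gram_op.
rewrite (@eq_mean _ _ _ _ (fun h => \sum_f \sum_g
   zeta e * K e f * K f g * zeta g * (cent a p e h * cent a p f h * cent a p g h))); last first.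
  move=> h; rewrite /c !mulr_sumr; apply: eq_bigr => f _.
  by rewrite !mulr_sumr; apply: eq_bigr => g _; ring.
transitivity (\sum_f kron e f * \sum_g kron f g * (zeta e * K e f * K f g * zeta g * s3)).
  rewrite mean_sum; apply: eq_bigr => f _; rewrite mean_sum mulr_sumr.
  by apply: eq_bigr => g _; rewrite meanZ (mean_cent3 meanE) -/s2 -/s3; ring.
by rewrite !sum_kron !Kdiag; ring.
Qed.

(** Pairings (ef)(gk) and (ek)(fg) give 4n Z each, (eg)(fk) gives (n + 6) Z, and full coincidence
    gives 8 Z with weight [s4 - 3 * s2 ^+ 2]. *)
Lemma mean_gram_form3 : mean w (r 3%N) = (s2 ^+ 2 * (9 * n%:R - 18) + 8 * s4) * Z.
Proof.
pose X e f g k : R := zeta e * K e f * K f g * K g k * zeta k.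
have -> : mean w (r 3%N) = \sum_e \sum_f \sum_g \sum_k
   (s2 ^+ 2 * (kron e f * (kron g k * X e f g k)) +
    (s2 ^+ 2 * (kron e k * (kron f g * X e f g k)) +
    (s2 ^+ 2 * (kron e g * (kron f k * X e f g k)) +
    (s4 - 3 * s2 ^+ 2) * (kron e f * (kron f g * (kron g k * X e f g k)))))).
  rewrite /r /gram_form mean_sum; apply: eq_bigr => e _ /=.
  rewrite /gram_op.
  rewrite (@eq_mean _ _ _ _ (fun h => \sum_f \sum_g \sum_k X e f g k *
     (cent a p e h * cent a p f h * cent a p g h * cent a p k h))); last first.
    move=> h; rewrite /c !mulr_sumr; apply: eq_bigr => f _.
    rewrite !mulr_sumr; apply: eq_bigr => g _; rewrite !mulr_sumr.
    by apply: eq_bigr => k _; rewrite /X; ring.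
  rewrite mean_sum; apply: eq_bigr => f _; rewrite mean_sum; apply: eq_bigr => g _.
  rewrite mean_sum; apply: eq_bigr => k _; rewrite meanZ (mean_cent4 meanE).
  by rewrite -/s2 -/s3 -/s4; ring.
under eq_bigr do under eq_bigr do under eq_bigr do
  rewrite !big_split /= -!mulr_sumr.
under eq_bigr do under eq_bigr do rewrite !big_split /= -!mulr_sumr.
under eq_bigr do rewrite !big_split /= -!mulr_sumr.
rewrite !big_split /= -!mulr_sumr.
have KKd e : \sum_f K e f * K e f = 2 * n%:R.
  by under eq_bigr => f _ do rewrite [X in _ * X]Ksym; rewrite KK Kdiag mulrC.
have t1 : \sum_e \sum_f kron e f * (\sum_g \sum_k kron g k * X e f g k) = 4 * n%:R * Z.
  under eq_bigr do rewrite sum_kron.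
  rewrite /Z mulr_sumr; apply: eq_bigr => e _; rewrite /X.
  under eq_bigr do rewrite sum_kron Kdiag.
  transitivity (4 * zeta e * \sum_g K e g * zeta g); last by rewrite Kzeta; ring.
  by rewrite mulr_sumr; apply: eq_bigr => g _; rewrite Kdiag; ring.
have t2 : \sum_e \sum_f \sum_g \sum_k kron e k * (kron f g * X e f g k) = 4 * n%:R * Z.
  rewrite /Z mulr_sumr; apply: eq_bigr => e _.
  under eq_bigr do under eq_bigr do rewrite sum_kron.
  under eq_bigr do rewrite sum_kron /X Kdiag.
  transitivity (2 * zeta e ^+ 2 * \sum_f K e f * K e f); last by rewrite KKd; ring.
  by rewrite mulr_sumr; apply: eq_bigr => f _; rewrite (Ksym f e); ring.
(* The summand is K_ef^3 zeta_e zeta_f. Off the diagonal the cube is K_ef itself; on it the cube is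
   8 instead of 2, whence the correction 6. *)
have t3 : \sum_e \sum_f \sum_g kron e g * (\sum_k kron f k * X e f g k) = (n%:R + 6) * Z.
  rewrite /Z mulr_sumr; apply: eq_bigr => e _.
  under eq_bigr do rewrite sum_kron sum_kron /X.
  transitivity (zeta e * (\sum_f (K e f * zeta f + kron e f * (6 * zeta f)))).
    rewrite mulr_sumr; apply: eq_bigr => f _; rewrite (Ksym f e) /kron.
    have [<-|ef] := eqVneq e f; first by rewrite Kdiag /=; ring.
    transitivity (zeta e * K e f ^+ 3 * zeta f); first by ring.
    by rewrite Kcube //=; ring.
  by rewrite big_split /= sum_kron Kzeta; ring.
have t4 : \sum_e \sum_f kron e f * (\sum_g kron f g * (\sum_k kron g k * X e f g k)) = 8 * Z.
  rewrite /Z mulr_sumr; apply: eq_bigr => e _.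
  by rewrite !sum_kron /X !Kdiag; ring.
rewrite t1 t2 t3 t4; ring.
Qed.

Lemma mean_laplacian_forms :
  let q m h := gram_form zeta (a ^~ h) (iter m (gram_op K (a ^~ h)) zeta) in
  [/\ mean w (q 0%N) = kappa1 p * Z, mean w (q 1%N) = kappa2 n p * Z,
      mean w (q 2%N) = kappa3 n p * Z & mean w (q 3%N) = kappa4 n p * Z].
Proof.
move=> q.
have aE h : a ^~ h = fun e => p + c h e.
  by apply/funext => e; rewrite /c /cent addrC subrK.
have ex h := gram_form_expand Ksym Kzeta KK p (c h).
have mean1 (x : R) : mean w (fun=> x) = x.
  rewrite -[RHS]mulr1 -(expr0 p) -(meanE [::]) -meanZ.
  by apply: eq_mean => h; rewrite big_nil mulr1.
have E0 : mean w (q 0%N) = mean w (fun h => p * Z + r 0%N h).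
  by apply: eq_mean => h; rewrite /q aE; case: (ex h).
have E1 : mean w (q 1%N) = mean w (fun h => p * (p * n%:R) * Z +
   (2 * (p * n%:R) * r 0%N h + r 1%N h)).
  by apply: eq_mean => h; rewrite /q aE; case: (ex h) => _ -> _ _; rewrite addrA.
have E2 : mean w (q 2%N) = mean w (fun h => p * (p * n%:R) ^+ 2 * Z +
   (3 * (p * n%:R) ^+ 2 * r 0%N h + (3 * (p * n%:R) * r 1%N h + r 2%N h))).
  by apply: eq_mean => h; rewrite /q aE; case: (ex h) => _ _ -> _; rewrite !addrA.
have E3 : mean w (q 3%N) = mean w (fun h => p * (p * n%:R) ^+ 3 * Z +
   (4 * (p * n%:R) ^+ 3 * r 0%N h + (6 * (p * n%:R) ^+ 2 * r 1%N h
   + (4 * (p * n%:R) * r 2%N h + r 3%N h)))).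
  by apply: eq_mean => h; rewrite /q aE; case: (ex h) => _ _ _ ->; rewrite !addrA.
rewrite E0 E1 E2 E3.
rewrite !meanD !meanZ !mean1 mean_gram_form0 mean_gram_form1 mean_gram_form2 mean_gram_form3.
by rewrite /kappa1 /kappa2 /kappa3 /kappa4 /s3 /s4 /s2; split; ring.
Qed.
End MeanGramForms.

(** * Graph Laplacians *)

(** Listing an edge with its smaller endpoint first fixes an orientation, and thereby the sign of
    x_e. *)
Notation vpair n := {e : 'I_n * 'I_n | (e.1 < e.2)%N}.

Lemma sum_vpair (V : zmodType) (n : nat) (F : 'I_n -> 'I_n -> V) :
  \sum_i \sum_j F i j =
  \sum_(e : vpair n) (F (val e).1 (val e).2 + F (val e).2 (val e).1) + \sum_i F i i.
Proof.
have sub (G : 'I_n -> 'I_n -> V) :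
    \sum_(e : vpair n) G (val e).1 (val e).2 = \sum_(i : 'I_n) \sum_(j : 'I_n | (i < j)%N) G i j.
  rewrite pair_big_dep /= -(big_sub [pred e : 'I_n * 'I_n | (e.1 < e.2)%N] (fun e => G e.1 e.2)).
  by apply: eq_bigl => -[i j].
rewrite big_split /= (sub F) (sub (fun i j => F j i)).
rewrite [X in _ = _ + X + _](exchange_big_dep predT) //= -!big_split /=; apply: eq_bigr => i _.
rewrite (bigD1 i) //= addrC; congr (_ + _).
rewrite (bigID (fun j : 'I_n => (i < j)%N)) /=; congr (_ + _).
  by apply: eq_bigl => j; rewrite -val_eqE /=; case: ltngtP.
by apply: eq_bigl => j; rewrite -val_eqE /=; case: ltngtP.
Qed.

(** The vector x_f = e_i - e_j of the edge f = {i, j}. Below, [gap v e] is x_e . v, and [edge_gram]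
    is the Gram matrix x_e . x_f. *)
Definition incidence (R : pzRingType) (n : nat) (f : vpair n) (i : 'I_n) : R :=
  (i == (val f).1)%:R - (i == (val f).2)%:R.

Definition gap (R : pzRingType) (n : nat) (v : 'I_n -> R) (e : vpair n) : R :=
  v (val e).1 - v (val e).2.

Definition edge_gram (R : pzRingType) (n : nat) (e f : vpair n) : R :=
  gap (incidence R f) e.

Definition edge_indic (R : pzRingType) (n : nat) (G : simple_graph n) (e : vpair n) : R :=
  (adjacent G (val e).1 (val e).2)%:R.

Lemma adjacentC n (G : simple_graph n) i j : adjacent G i j = adjacent G j i.
Proof. by rewrite /adjacent finset.setUC. Qed.

Lemma laplacian_mulE (R : realType) n (G : simple_graph n) (v : 'cV[R]_n) i :
  (laplacian R G *m v) i ord0 = \sum_j (adjacent G i j)%:R * (v i ord0 - v j ord0).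
Proof.
rewrite /laplacian mulmxBl mxE [X in X + _]mxE [X in _ + X]mxE [X in _ - X]mxE.
rewrite (bigD1 i) //= big1 ?addr0 => [|j ji]; last first.
  by rewrite !mxE eq_sym (negbTE ji) mulr0n mul0r.
rewrite !mxE eqxx mulr1n /vertex_degree -sum1_card natr_sum mulr_suml.
rewrite big_mkcond /= -sumrB; apply: eq_bigr => j _.
by rewrite inE mxE; case: adjacent => /=; ring.
Qed.

(** This is L = sum_e b_e x_e x_e^T: the terms (i, j) and (j, i) of the double sum combine into one
    product of gaps. *)
Lemma laplacian_bilin (R : realType) n (G : simple_graph n) (u : 'I_n -> R) (v : 'cV[R]_n) :
  \sum_i u i * (laplacian R G *m v) i ord0 =
  \sum_e gap u e * (edge_indic R G e * gap (v ^~ ord0) e).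
Proof.
transitivity (\sum_i \sum_j u i * ((adjacent G i j)%:R * (v i ord0 - v j ord0))).
  by apply: eq_bigr => i _; rewrite laplacian_mulE mulr_sumr.
rewrite sum_vpair [X in _ + X]big1 ?addr0 => [|i _]; last by rewrite subrr !mulr0.
apply: eq_bigr => e _; rewrite /edge_indic /gap (adjacentC G (val e).2); ring.
Qed.

Lemma sum_incidence (R : comPzRingType) n (e : vpair n) (v : 'I_n -> R) :
  \sum_i incidence R e i * v i = gap v e.
Proof.
have d (k : 'I_n) : \sum_i (i == k)%:R * v i = v k.
  rewrite (bigD1 k) //= eqxx mul1r big1 ?addr0 // => i ik.
  by rewrite (negbTE ik) mul0r.
by rewrite /incidence; under eq_bigr do rewrite mulrBl; rewrite sumrB !d.
Qed.

Lemma edge_gram_sym (R : comPzRingType) n (e f : vpair n) :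
  edge_gram R e f = edge_gram R f e.
Proof.
rewrite /edge_gram /gap /incidence.
rewrite [(val e).1 == (val f).1]eq_sym [(val e).1 == (val f).2]eq_sym.
by rewrite [(val e).2 == (val f).1]eq_sym [(val e).2 == (val f).2]eq_sym; ring.
Qed.

Lemma edge_gram_diag (R : comPzRingType) n (e : vpair n) : edge_gram R e e = 2.
Proof.
rewrite /edge_gram /gap /incidence !eqxx.
have /negbTE ne : (val e).1 != (val e).2.
  by apply/eqP => h; have := valP e; rewrite h ltnn.
by rewrite ne eq_sym ne /=; ring.
Qed.

(** Distinct edges share at most one vertex, so their inner product is -1, 0 or 1. *)
Lemma edge_gram_cube (R : comPzRingType) n (e f : vpair n) : e != f ->
  edge_gram R e f ^+ 3 = edge_gram R e f.
Proof.
move=> ef; rewrite /edge_gram /gap /incidence.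
move: (valP e) (valP f) ef; rewrite -val_eqE.
case: (val e) => a b; case: (val f) => c d /= ab cd.
rewrite xpair_eqE.
have [?|ac] := eqVneq a c; have [?|ad] := eqVneq a d;
have [?|bc] := eqVneq b c; have [?|bd] := eqVneq b d;
  rewrite //=; try (by move=> _; ring); subst => _; exfalso.
all: move: ab cd; rewrite ?ltnn //; try by move=> /ltn_trans h /h; rewrite ltnn.
Qed.

(** This is sum_f x_f x_f^T = nI - J, paired with x_e, which is orthogonal to the ones vector.
    Taking [v] to be an incidence vector yields K^2 = nK. *)
Lemma edge_gram_gap (R : numDomainType) n (e : vpair n) (v : 'I_n -> R) :
  \sum_f edge_gram R e f * gap v f = n%:R * gap v e.
Proof.
(* Twice a sum over edges is a sum over all ordered pairs, which separates into single sums. *)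
apply: (@mulfI _ (2 : R)); first by rewrite pnatr_eq0.
transitivity (\sum_i \sum_j
    (incidence R e i - incidence R e j) * (v i - v j)).
  rewrite sum_vpair [X in _ = _ + X]big1 ?addr0 => [|i _]; last by rewrite subrr mul0r.
  rewrite mulr_sumr; apply: eq_bigr => f _.
  by rewrite edge_gram_sym /edge_gram /gap; ring.
have i0 : \sum_i incidence R e i = 0.
  under eq_bigr do rewrite -[incidence R e _]mulr1.
  by rewrite sum_incidence /gap subrr.
transitivity (\sum_i (n%:R * (incidence R e i * v i) - incidence R e i * (\sum_j v j)
   + gap v e)).
  apply: eq_bigr => i _.
  under eq_bigr do rewrite mulrBl !mulrBr opprB.
  rewrite !big_split /= sumr_const card_ord !sumrN -!mulr_sumr -mulr_suml i0 mul0r.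
  by rewrite sum_incidence mulr_natl; ring.
rewrite big_split sumrB /= -mulr_sumr -mulr_suml i0 mul0r sum_incidence.
by rewrite sumr_const card_ord -[gap v e *+ n]mulr_natl; ring.
Qed.

Lemma sum_gap_sqr (R : numDomainType) n (v : 'I_n -> R) : \sum_i v i = 0 ->
  \sum_e gap v e ^+ 2 = n%:R * \sum_i v i ^+ 2.
Proof.
move=> v0; apply: (@mulfI _ (2 : R)); first by rewrite pnatr_eq0.
transitivity (\sum_i \sum_j (v i - v j) ^+ 2).
  rewrite sum_vpair [X in _ = _ + X]big1 ?addr0 => [|i _]; last by rewrite subrr expr0n.
  by rewrite mulr_sumr; apply: eq_bigr => f _; rewrite /gap; ring.
transitivity (\sum_i (n%:R * v i ^+ 2 + \sum_j v j ^+ 2)).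
  apply: eq_bigr => i _.
  transitivity (\sum_(j < n) (v i ^+ 2 + (v j ^+ 2 - 2 * v i * v j))).
    by apply: eq_bigr => j _; ring.
  by rewrite !big_split /= sumr_const card_ord sumrN -mulr_sumr v0 mulr_natl; ring.
rewrite big_split /= sumr_const card_ord -mulr_sumr.
by rewrite -[(\sum_j v j ^+ 2) *+ n]mulr_natl; ring.
Qed.

Lemma laplacian_sym (R : realType) n (G : simple_graph n) :
  (laplacian R G)^T = laplacian R G.
Proof.
apply/matrixP => i j; rewrite !mxE adjacentC; congr (_ - _).
by rewrite eq_sym; case: eqVneq => // ->.
Qed.

Lemma laplacian_quadE (R : realType) n (G : simple_graph n) (u v : 'cV[R]_n) :
  (u^T *m (laplacian R G *m v)) ord0 ord0 =
  \sum_e gap (u ^~ ord0) e * (edge_indic R G e * gap (v ^~ ord0) e).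
Proof.
by rewrite -laplacian_bilin mxE; apply: eq_bigr => i _; rewrite mxE.
Qed.

Lemma laplacian_psd (R : realType) n (G : simple_graph n) (v : 'cV[R]_n) :
  0 <= (v^T *m laplacian R G *m v) ord0 ord0.
Proof.
rewrite -mulmxA laplacian_quadE sumr_ge0 // => e _.
by rewrite mulrCA mulr_ge0 -?expr2 ?sqr_ge0 // ler0n.
Qed.

(** Passing to edge coordinates intertwines [L] with [gram_op], since x_e . Lv = sum_f (x_e . x_f)
    b_f (x_f . v). *)
Lemma gap_laplacian (R : realType) n (G : simple_graph n) (v : 'cV[R]_n) :
  gap ((laplacian R G *m v) ^~ ord0) =
  gram_op (@edge_gram R n) (edge_indic R G) (gap (v ^~ ord0)).
Proof.
apply/funext => e; rewrite -sum_incidence laplacian_bilin.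
by apply: eq_bigr => f _; rewrite edge_gram_sym.
Qed.

Lemma laplacian_exp_form (R : realType) n (G : simple_graph n) (z : 'cV[R]_n) m :
  (z^T *m laplacian R G ^+ m.+1 *m z) ord0 ord0 =
  gram_form (gap (z ^~ ord0)) (edge_indic R G)
    (iter m (gram_op (@edge_gram R n) (edge_indic R G)) (gap (z ^~ ord0))).
Proof.
rewrite expmxS -!mulmxA laplacian_quadE /gram_form.
suff -> : gap ((laplacian R G ^+ m *m z) ^~ ord0) =
    iter m (gram_op (@edge_gram R n) (edge_indic R G)) (gap (z ^~ ord0)) by [].
elim: m => [|m IH]; first by rewrite expr0 mul1mx.
by rewrite expmxS -mulmxA gap_laplacian IH.
Qed.

HB.instance Definition _ (n : nat) := Finite.copy (simple_graph n)
  {E : {set {set 'I_n}} | E \subset [set e | is_edge e]%SET}.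

(** The Taylor bound is averaged term by term. The m-th moment has mean kappa_m sum_e (x_e . z)^2 =
    n kappa_m |z|^2, which at t = 1/n assembles to [n%:R * mu n p]. *)
Lemma mean_norm2_expm_le (R : realType) (n : nat) (p : R) (w : simple_graph n -> R)
    (z : 'cV[R]_n) :
  (0 < n)%N -> (forall G, 0 <= w G) ->
  (forall s : seq (vpair n),
    mean w (fun G => \prod_(e <- s) edge_indic R G e) = p ^+ size (undup s)) ->
  \sum_i z i ord0 = 0 ->
  mean w (fun G => norm2 (expm (- ((1 / n%:R) *: laplacian R G)) *m z) ^+ 2)
    <= (1 + n%:R * mu n p) * norm2 z ^+ 2.
Proof.
move=> n0 w0 wE z0.
have n0' : n%:R != 0 :> R by rewrite pnatr_eq0 -lt0n.
pose q m G := (z^T *m laplacian R G ^+ m *m z) ord0 ord0.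
pose t : R := 1 / n%:R.
have le4 G : norm2 (expm (- ((1 / n%:R) *: laplacian R G)) *m z) ^+ 2 <=
    norm2 z ^+ 2 + (- (2 * t) * q 1%N G + (2 * t ^+ 2 * q 2%N G +
      (- (4 / 3 * t ^+ 3) * q 3%N G + 2 / 3 * t ^+ 4 * q 4%N G))).
  apply: le_trans (norm2_expmN_le_taylor4 z (laplacian_sym R G) (laplacian_psd G) _) _.
    by rewrite divr_ge0.
  rewrite expr0 mulmx1 -norm2_sqr -/(q 1%N G) -/(q 2%N G) -/(q 3%N G) -/(q 4%N G) -/t.
  by rewrite le_eqVlt; apply/orP; left; apply/eqP; ring.
apply: le_trans (mean_le w0 le4) _.
have mean1 (x : R) : mean w (fun=> x) = x.
  rewrite -[RHS]mulr1 -(expr0 p) -(wE [::]) -meanZ.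
  by apply: eq_mean => h; rewrite big_nil mulr1.
rewrite !meanD !meanZ mean1.
have [] := mean_laplacian_forms wE (@edge_gram_sym R n) (@edge_gram_diag R n)
  (@edge_gram_cube R n) (fun e => edge_gram_gap e (z ^~ ord0))
  (fun e g => edge_gram_gap e (incidence R g)).
have qE m : mean w (q m.+1) = mean w (fun G => gram_form (gap (z ^~ ord0)) (edge_indic R G)
    (iter m (gram_op (@edge_gram R n) (edge_indic R G)) (gap (z ^~ ord0)))).
  by apply: eq_mean => G; exact: laplacian_exp_form.
rewrite (sum_gap_sqr z0) -!qE => -> -> -> ->.
have -> : \sum_i z i ord0 ^+ 2 = norm2 z ^+ 2.
  by rewrite norm2_sqr mxE; apply: eq_bigr => i _; rewrite mxE expr2.
by rewrite le_eqVlt /t /mu; apply/orP; left; apply/eqP; field.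
Qed.

(** * Centering and orthogonality to the ones vector *)

Lemma centered_expm (R : realType) (n : nat) (A : 'M[R]_n) (v : 'cV[R]_n) :
  A *m ones_mx R n = 0 -> ones_mx R n *m A = 0 ->
  centered (expm A *m v) = expm A *m centered v.
Proof.
move=> AJ JA; rewrite /centered !mulmxA expm_comm //.
by rewrite mulmxBl mulmxBr mul1mx mulmx1 -scalemxAl -scalemxAr AJ JA.
Qed.

Lemma laplacian_ones (R : realType) (n : nat) (G : simple_graph n) :
  laplacian R G *m ones_mx R n = 0.
Proof.
apply/matrixP => i j; rewrite [RHS]mxE.
transitivity ((laplacian R G *m (const_mx 1 : 'cV[R]_n)) i ord0).
  by rewrite mxE [RHS]mxE; apply: eq_bigr => k _; rewrite [X in _ * X]mxE [X in _ = _ * X]mxE.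
by rewrite laplacian_mulE big1 // => k _; rewrite !mxE subrr mulr0.
Qed.

Lemma ones_laplacian (R : realType) (n : nat) (G : simple_graph n) :
  ones_mx R n *m laplacian R G = 0.
Proof.
apply: trmx_inj; rewrite trmx_mul laplacian_sym trmx0.
have -> : (ones_mx R n)^T = ones_mx R n by apply/matrixP => i j; rewrite !mxE.
exact: laplacian_ones.
Qed.

Lemma ones_centered (R : realType) (n : nat) (v : 'cV[R]_n) : (0 < n)%N ->
  ones_mx R n *m centered v = 0.
Proof.
move=> n0; rewrite /centered mulmxA mulmxBr mulmx1 -scalemxAr.
have -> : ones_mx R n *m ones_mx R n = n%:R *: ones_mx R n.
  apply/matrixP => i j; rewrite !mxE; under eq_bigr do rewrite !mxE mulr1.
  by rewrite sumr_const card_ord mulr1.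
by rewrite scalerA mulVf ?pnatr_eq0 -?lt0n // scale1r subrr mul0mx.
Qed.

Lemma sum_ones_mul0 (R : realType) (n : nat) (v : 'cV[R]_n) :
  ones_mx R n *m v = 0 -> \sum_i v i ord0 = 0.
Proof.
case: n v => [|n] v; first by rewrite big_ord0.
move=> /matrixP/(_ ord0 ord0); rewrite mxE [RHS]mxE => Jv; rewrite -[RHS]Jv.
by apply: eq_bigr => i _; rewrite mxE mul1r.
Qed.

(** [Lhat] acts as the scalar n on vectors killed by J, which cancels the factor 1/n. *)
Lemma lyapunov_norm2 (R : realType) (n : nat) (v : 'cV[R]_n) : (0 < n)%N ->
  ones_mx R n *m v = 0 -> lyapunov v = norm2 v ^+ 2.
Proof.
move=> n0 Jv; rewrite /lyapunov /Lhat -mulmxA mulmxBl Jv subr0 mul_scalar_mx.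
rewrite -scalemxAr mxE norm2_sqr mulrA mulVf ?mul1r // pnatr_eq0 -lt0n //.
Qed.

(** * Finite-valued random elements *)

Section FiniteValued.
Context {d : measure_display} {T : measurableType d} {R : realType} (P : probability T R).
Context {F : finType} (X : T -> F).
Hypothesis mX : forall x, measurable (X @^-1` [set x]).

Lemma measurable_preimage_fin (S : set F) : measurable (X @^-1` S).
Proof.
have -> : X @^-1` S = \bigcup_(x in S) X @^-1` [set x].
  by apply/seteqP; split=> [w Sw|w [x Sx /= ->]] //; exists (X w).
by apply: fin_bigcup_measurable => //; exact: finite_finset.
Qed.

Lemma integral_fin_valued (f : F -> R) (A : set T) : measurable A ->
  P.-integrable A (fun w => (f (X w))%:E) /\
  (\int[P]_(w in A) (f (X w))%:E = (\sum_x f x * fine (P (A `&` X @^-1` [set x])))%:E)%E.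
Proof.
move=> mA.
have fE : (fun w => (f (X w))%:E) =
    fun w => (\sum_(x : F) (f x)%:E * (\1_(X @^-1` [set x]) w)%:E)%E.
  apply/funext => w; rewrite (bigD1 (X w)) //= big1 ?adde0 => [|x xw].
    by rewrite indicE mem_set // mule1.
  by rewrite indicE memNset ?mule0 // => /= h; rewrite h eqxx in xw.
have int1 x : P.-integrable A (fun w => (\1_(X @^-1` [set x]) w)%:E).
  apply: (integrableS measurableT) => //; exact: integrable_indic.
have int2 x : P.-integrable A (fun w => ((f x)%:E * (\1_(X @^-1` [set x]) w)%:E)%E).
  exact: integrableZl.
rewrite fE; split; first exact: integrable_sum.
rewrite integral_sum // -sumEFin; apply: eq_bigr => x _.
rewrite integralZl // integral_indic // setIC EFinM fineK //.
by apply: fin_num_measure; exact: measurableI.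
Qed.

Lemma probability_fin_valued (S : set F) :
  P (X @^-1` S) = (\sum_(x | x \in S) fine (P (X @^-1` [set x])))%:E.
Proof.
have mS := measurable_preimage_fin S.
have [_] := integral_fin_valued (fun=> 1) mS.
rewrite integral_cst // mul1e => ->; congr EFin.
rewrite [RHS]big_mkcond; apply: eq_bigr => x _; rewrite mul1r.
case: ifPn => [/set_mem Sx|/negP nSx].
  by congr (fine (P _)); apply/seteqP; split=> [w []//|w /= wx]; rewrite wx.
rewrite (_ : _ `&` _ = set0) ?measure0 //.
by apply/seteqP; split=> // w /= [Sw wx]; apply: nSx; rewrite -wx mem_set.
Qed.

End FiniteValued.

Section SigmaOf.
Context {T : Type} {R : realType} {n : nat} {F : finType} (X : T -> F) (psi : F -> 'cV[R]_n).

(** [B] need not be Borel: only its finitely many points in the range of [psi] matter, and a finite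
    set of points is Borel. *)
Lemma sigma_of_fin_valued (B : set 'cV[R]_n) :
  sigma_of (psi \o X) ((psi \o X) @^-1` B).
Proof.
exists (\bigcup_(x in psi @^-1` B) [set psi x]); last first.
  rewrite setTI; apply/seteqP; split=> [w [x /= Bx wx]|w /= Bw]; last by exists (X w).
  by rewrite /= wx.
apply: (@fin_bigcup_measurable _ (g_sigma_algebraType [set U : set 'cV[R]_n | open U])).
  exact: finite_finset.
move=> x _; rewrite -[X in measurable X]setCK; apply: measurableC.
apply: sub_sigma_algebra => /=; rewrite openC.
exact/accessible_closed_set1/hausdorff_accessible/norm_hausdorff.
Qed.

End SigmaOf.

(** * Conditional expectation given a finite-valued vector *)

Section CondExp.
Context {d : measure_display} {T : measurableType d} {R : realType} (P : probability T R).
Context {F : finType} (X : T -> F) {n : nat} (psi : F -> 'cV[R]_n) (phi : F -> R).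
Hypothesis mX : forall x, measurable (X @^-1` [set x]).

Let q x := fine (P (X @^-1` [set x])).

Lemma atom_weight_ge0 x : 0 <= q x. Proof. exact: fine_ge0. Qed.

Lemma integral_sigma_of (f : F -> R) (U : set 'cV[R]_n) :
  (\int[P]_(w in (psi \o X) @^-1` U) (f (X w))%:E =
    (\sum_(x | psi x \in U) f x * q x)%:E)%E.
Proof.
have mU := measurable_preimage_fin mX (psi @^-1` U).
have [_ ->] := integral_fin_valued P mX f mU; congr EFin.
rewrite [RHS]big_mkcond; apply: eq_bigr => x _.
case: ifPn => [/set_mem Ux|/negP nUx].
  by congr (_ * fine (P _)); apply/seteqP; split=> [w []//|w /= wx]; rewrite wx.
rewrite (_ : _ `&` _ = set0) ?measure0 ?mulr0 //.
by apply/seteqP; split=> // w /= [Uw wx]; apply: nUx; rewrite -wx mem_set.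
Qed.

(** The weighted average of [phi] over the atom at [u]; on an atom of mass zero the division yields
    0. *)
Definition atom_avg (u : 'cV[R]_n) : R :=
  (\sum_(x | psi x == u) phi x * q x) / (\sum_(x | psi x == u) q x).

Lemma is_cond_exp_atom_avg :
  is_cond_exp P (sigma_of (psi \o X)) (phi \o X) (atom_avg \o psi \o X).
Proof.
split.
- by have [] := integral_fin_valued P mX phi measurableT.
- by move=> B _; exact: (sigma_of_fin_valued X psi (atom_avg @^-1` B)).
- by have [] := integral_fin_valued P mX (atom_avg \o psi) measurableT.
- move=> _ [U _ <-]; rewrite setTI.
  rewrite (integral_sigma_of (atom_avg \o psi)) integral_sigma_of; congr EFin.
  rewrite /= /atom_avg.
  transitivity (\sum_(x | psi x \in U) \sum_(y | psi y == psi x)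
      phi y * q y * (q x / \sum_(y | psi y == psi x) q y)).
    apply: eq_bigr => x _; rewrite mulrAC -mulrA mulr_suml.
    by apply: eq_bigr => y _; ring.
  rewrite (exchange_big_dep (fun y => psi y \in U)) /=; last first.
    by move=> x y Ux /eqP ->.
  apply: eq_bigr => y Uy.
  transitivity (phi y * q y * (\sum_(x | psi x == psi y) q x / \sum_(x | psi x == psi y) q x)).
    rewrite -mulr_sumr; congr (_ * _); apply: eq_big => [x|x /andP[_ /eqP ->]] //.
    by rewrite eq_sym; case: eqP => [->|]; rewrite ?andbF // Uy.
  rewrite -mulr_suml.
  (* On a null atom the quotient is not 1, but every weight in that atom vanishes. *)
  have [S0|S0] := eqVneq (\sum_(x | psi x == psi y) q x) 0; last by rewrite mulfV // mulr1.
  have -> : q y = 0 by apply: (psumr_eq0P _ S0) => [x _|]; [exact: atom_weight_ge0 | exact: eqxx].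
  by rewrite mulr0 mul0r.
Qed.

(** A version of the conditional expectation is constant on each atom, so integrating over an atom
    of positive mass identifies its value with the average of [phi] there. *)
Lemma cond_exp_le (g : 'cV[R]_n -> R) (Y : T -> R) :
  (forall u, \sum_(x | psi x == u) phi x * q x <= g u * \sum_(x | psi x == u) q x) ->
  is_cond_exp P (sigma_of (psi \o X)) (phi \o X) Y ->
  {ae P, forall w, Y w <= g (psi (X w))}.
Proof.
move=> phig [_ Ymeas Yint Yavg].
exists (X @^-1` [set x | q x = 0]); split.
- exact: measurable_preimage_fin.
- rewrite probability_fin_valued // big1 // => x /set_mem; exact.
- move=> w /= nYw; apply: contra_notP nYw => qw.
  pose u := psi (X w); pose S := \sum_(x | psi x == u) q x.
  have Spos : 0 < S.
    rewrite /S (bigD1 (X w)) //= ltr_pwDl ?sumr_ge0 // => [|x _]; last exact: atom_weight_ge0.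
    by rewrite lt_neqAle atom_weight_ge0 andbT eq_sym; exact/eqP.
  (* The level set of [Y] through [w] is a preimage under [psi \o X], so it contains the whole atom
     of [w]. *)
  have [V _ YV] := Ymeas [set Y w] (measurable_set1 _).
  have Vw : V u.
    have : (Y @^-1` [set Y w]) w by [].
    by rewrite -YV => -[].
  have Yatom w' : ((psi \o X) @^-1` [set u]) w' -> Y w' = Y w.
    move=> /= uw'; have : (setT `&` (psi \o X) @^-1` V) w' by split=> //=; rewrite uw'.
    by rewrite YV.
  have := Yavg _ (sigma_of_fin_valued X psi [set u]).
  have eqS (x : F) : (psi x \in [set u]%classic) = (psi x == u).
    by apply/idP/eqP => [/set_mem|?]; rewrite ?inE.
  rewrite integral_sigma_of.
  rewrite (eq_integral (fun=> (Y w)%:E)); last first.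
    by move=> w' /set_mem/Yatom ->.
  rewrite (integral_sigma_of (fun=> Y w)) => -[].
  under eq_bigl do rewrite eqS.
  rewrite -mulr_sumr -/S => YS.
  rewrite -(ler_pM2r Spos) YS; under eq_bigl do rewrite eqS.
  exact: phig.
Qed.

End CondExp.

(** * Histories of random graphs *)

Definition vpair_edge (n : nat) (e : vpair n) : {set 'I_n} :=
  [set (val e).1; (val e).2]%SET.

Lemma is_edge_vpair n (e : vpair n) : is_edge (vpair_edge e).
Proof.
rewrite /is_edge cards2; suff -> : (val e).1 != (val e).2 by [].
by apply/eqP => h; have := valP e; rewrite h ltnn.
Qed.

Lemma vpair_edge_inj n : injective (@vpair_edge n).
Proof.
move=> e f /setP ef; apply: val_inj; move: (valP e) (valP f) ef.
rewrite /vpair_edge; case: (val e) => a b; case: (val f) => c d /= ab cd ef.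
have := ef a; have := ef b; have := ef c; have := ef d.
rewrite !inE !eqxx ?orbT /=.
have [ad|ad] := eqVneq a d; have [bc|bc] := eqVneq b c;
have [ac|ac] := eqVneq a c; have [bd|bd] := eqVneq b d; subst=> //=.
by move: (ltn_trans ab cd); rewrite ltnn.
Qed.

Section RandomGraphs.
Context {d : measure_display} {T : measurableType d} {R : realType} (P : probability T R).
Context {n : nat}.

(** The product is the indicator that all edges in [s] are present. The finite set [J] forgets
    repetitions, so independence gives one factor [p] per distinct edge. *)
Lemma mean_edge_prod (p : R) (G : T -> simple_graph n) (s : seq (vpair n)) :
  (forall g, measurable (G @^-1` [set g])) -> erdos_renyi P p G ->
  mean (fun g => fine (P (G @^-1` [set g]))) (fun g => \prod_(e <- s) edge_indic R g e)
    = p ^+ size (undup s).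
Proof.
move=> mG [Pedge [_ indep]].
pose S := [set g : simple_graph n | forall e, e \in s -> vpair_edge e \in edges g].
pose J := [fset x in map (@vpair_edge n) s]%fset.
have SE : G @^-1` S = \bigcap_(e in [set` J]) edge_event G e.
  apply/seteqP; split=> [w Sw e /=|w Gw e es].
    by rewrite inE => /mapP[f fs ->]; exact: Sw.
  by apply: (Gw (vpair_edge e)); rewrite /= inE map_f.
have Jedge e : e \in J -> is_edge e.
  by rewrite inE => /mapP[f _ ->]; exact: is_edge_vpair.
have PS : P (G @^-1` S) = (p ^+ size (undup s))%:E.
  have -> : P (G @^-1` S) = (\prod_(e <- J) P (edge_event G e))%E.
    by rewrite SE; apply: indep => [e /Jedge|].
  rewrite (eq_big_seq (fun=> p%:E)) => [|e /Jedge]; last exact: Pedge.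
  rewrite prodEFin big_const_seq count_predT iter_mulr_1 card_fseq.
  by rewrite undup_map_inj ?size_map //; exact: vpair_edge_inj.
move: PS; rewrite probability_fin_valued // => -[<-].
rewrite /mean [RHS]big_mkcond; apply: eq_bigr => g _.
have -> : \prod_(e <- s) edge_indic R g e = (g \in S)%:R.
  have -> : (g \in S) = all (fun e => vpair_edge e \in edges g) s.
    by apply/idP/allP => [/set_mem|h]; rewrite ?inE.
  by elim: s {S J SE Jedge} => [|e s IH]; rewrite ?big_nil // big_cons IH /= -natrM mulnb.
by case: (g \in S); rewrite ?mulr1 ?mulr0.
Qed.

Context (G : nat -> T -> simple_graph n).
Hypothesis Gind : independent_graphs P G.

Lemma graph_measurable k (B : set (simple_graph n)) : measurable (G k @^-1` B).
Proof.
case: Gind => mG _; apply: (mG k) => //; exists B => //.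
by rewrite setTI.
Qed.

Lemma probability_bigcap_graph k (A : nat -> set (simple_graph n)) :
  P (\bigcap_(i in `I_k) G i @^-1` A i) = (\prod_(0 <= i < k) P (G i @^-1` A i))%E.
Proof.
case: Gind => _ ind.
have -> : `I_k = [set` [fset x in iota 0 k]%fset].
  by apply/seteqP; split=> i /=; rewrite inE mem_iota add0n.
rewrite (ind _ (fun i => G i @^-1` A i)) // => [|i _]; last by exists (A i); rewrite ?setTI.
apply: perm_big; rewrite uniq_perm ?fset_uniq ?iota_uniq // => i.
by rewrite inE /index_iota subn0.
Qed.

(** The first k graphs, packed into a finite type so that expectations become finite sums. *)
Fixpoint hist (k : nat) : finType :=
  if k is k'.+1 then (hist k' * simple_graph n)%type else unit.

Fixpoint history (k : nat) (w : T) : hist k :=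
  match k with 0 => tt | k'.+1 => (history k' w, G k' w) end.

Lemma history_eventS k (h : hist k) (g : simple_graph n) (A : nat -> set (simple_graph n)) :
  history k @^-1` [set h] = \bigcap_(i in `I_k) G i @^-1` A i ->
  history k.+1 @^-1` [set (h, g)] =
    \bigcap_(i in `I_k.+1) G i @^-1` (if i == k then [set g] else A i).
Proof.
move=> hA; apply/seteqP; split=> [w /= [wh wg] i /=|w Gw].
  rewrite ltnS leq_eqVlt => /predU1P[->|ik]; first by rewrite eqxx.
  rewrite ltn_eqF //; have : (history k @^-1` [set h]) w by [].
  by rewrite hA; exact.
change ((history k w, G k w) = (h, g)).
congr pair; last by have := Gw k (ltnSn k); rewrite /= eqxx.
suff : (history k @^-1` [set h]) w by [].
rewrite hA => i /= ik; have := Gw i; rewrite /= ltn_eqF //; apply.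
exact: ltnW.
Qed.

(** Fixing a history is a cylinder event, the form to which the product rule applies. *)
Lemma history_event k (h : hist k) : exists A : nat -> set (simple_graph n),
  history k @^-1` [set h] = \bigcap_(i in `I_k) G i @^-1` A i.
Proof.
elim: k h => [[]|k IH [h g]].
  by exists (fun=> setT); rewrite II0 bigcap_set0; apply/seteqP; split=> w //=; case: history.
have [A hA] := IH h.
by exists (fun i => if i == k then [set g] else A i); exact: history_eventS.
Qed.

Lemma history_measurable k (h : hist k) : measurable (history k @^-1` [set h]).
Proof.
have [A ->] := history_event h; apply: fin_bigcap_measurable => [|i _].
- exact: finite_II.
- exact: graph_measurable.
Qed.

Definition hist_weight k (h : hist k) : R := fine (P (history k @^-1` [set h])).
Definition graph_weight k (g : simple_graph n) : R := fine (P (G k @^-1` [set g])).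

(** The newest graph is independent of the past: the product over k+1 cylinder factors splits off
    its last one. *)
Lemma hist_weightS k (h : hist k) g :
  @hist_weight k.+1 (h, g) = hist_weight h * graph_weight k g.
Proof.
have [A hA] := history_event h.
rewrite /hist_weight (history_eventS g hA) probability_bigcap_graph big_nat_recr //= eqxx.
rewrite (@eq_big_nat _ _ _ _ _ _ (fun i => P (G i @^-1` A i))); last first.
  by move=> i /andP[_ ik]; rewrite ltn_eqF.
rewrite -probability_bigcap_graph -hA fineM //; apply: fin_num_measure.
- exact: history_measurable.
- exact: graph_measurable.
Qed.

End RandomGraphs.

(** * The consensus iteration *)

Section Consensus.
Context {d : measure_display} {T : measurableType d} {R : realType} (P : probability T R).
Context {n : nat} (p : R) (v0 : 'cV[R]_n) (G : nat -> T -> simple_graph n).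
Hypothesis n0 : (0 < n)%N.
Hypothesis Jv0 : ones_mx R n *m v0 = 0.
Hypothesis GER : forall k, erdos_renyi P p (G k).
Hypothesis Gind : independent_graphs P G.

Let step (g : simple_graph n) := expm (- ((1 / n%:R) *: laplacian R g)).
Let rate := n%:R * mu n p.

Fixpoint hist_state (k : nat) : @hist n k -> 'cV[R]_n :=
  match k with
  | 0 => fun=> v0
  | k'.+1 => fun h => step h.2 *m hist_state h.1
  end.

Lemma graph_weight_ge0 k g : 0 <= graph_weight P G k g.
Proof. exact: fine_ge0. Qed.

Lemma hist_weight_ge0 k (h : hist k) : 0 <= hist_weight P G h.
Proof. exact: fine_ge0. Qed.

Lemma sum_graph_weight k : \sum_g graph_weight P G k g = 1.
Proof.
have mG g := graph_measurable Gind k [set g].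
apply: EFin_inj; have := probability_fin_valued P mG setT.
rewrite preimage_setT probability_setT => ->; congr EFin.
by apply: eq_bigl => g; rewrite in_setT.
Qed.

Lemma ones_hist_state k (h : hist k) : ones_mx R n *m hist_state h = 0.
Proof.
elim: k h => [|k IH h] //=; rewrite mulmxA -expm_comm ?IH -?mulmxA ?IH ?mulmx0 //.
by rewrite mulNmx mulmxN -scalemxAl -scalemxAr laplacian_ones ones_laplacian.
Qed.

Lemma norm2_step_le (g : simple_graph n) (v : 'cV[R]_n) :
  norm2 (step g *m v) ^+ 2 <= norm2 v ^+ 2.
Proof.
apply: norm2_expmN_le; [exact: laplacian_sym|exact: laplacian_psd|].
by rewrite divr_ge0.
Qed.

Lemma mean_step_le k (v : 'cV[R]_n) : ones_mx R n *m v = 0 ->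
  \sum_g graph_weight P G k g * norm2 (step g *m v) ^+ 2 <= (1 + rate) * norm2 v ^+ 2.
Proof.
move=> Jv; apply: (@mean_norm2_expm_le _ _ p (graph_weight P G k)) => //.
- by move=> g; exact: graph_weight_ge0.
- move=> s; apply: mean_edge_prod => // g; exact: (graph_measurable Gind).
- exact: sum_ones_mul0.
Qed.

(** Fubini for the product law: average over the newest graph first, with the past fixed. *)
Lemma sum_histS k (f : @hist n k -> simple_graph n -> R) :
  \sum_(x : hist k.+1) f x.1 x.2 * hist_weight P G x =
  \sum_(h : hist k) hist_weight P G h * \sum_g graph_weight P G k g * f h g.
Proof.
rewrite (eq_bigr (fun x => f x.1 x.2 * (hist_weight P G x.1 * graph_weight P G k x.2))).
  rewrite -(pair_bigA _ (fun h g => f h g * (hist_weight P G h * graph_weight P G k g))) /=.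
  apply: eq_bigr => h _; rewrite mulr_sumr; apply: eq_bigr => g _; ring.
by move=> [h g] _; rewrite hist_weightS.
Qed.

(** The one-step bound places a nonnegative mean below (1 + rate) |v0|^2, and |v0|^2 is positive.
    The sign is needed to multiply the induction hypothesis by this factor. *)
Lemma one_plus_rate_ge0 : v0 != 0 -> 0 <= 1 + rate.
Proof.
move=> v00; have := mean_step_le 0%N Jv0; set s := (X in X <= _) => le_s.
have s0 : 0 <= s.
  by apply: sumr_ge0 => g _; rewrite mulr_ge0 ?sqr_ge0 ?graph_weight_ge0.
have : 0 < norm2 v0 ^+ 2.
  rewrite lt_neqAle sqr_ge0 andbT; apply/eqP => /esym nv0; move/negP: v00; apply.
  apply/eqP/colP => i; rewrite [RHS]mxE; move: nv0; rewrite norm2_sqr mxE.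
  move=> /psumr_eq0P/(_ i isT); rewrite mxE => h.
  apply/eqP; rewrite -[_ == 0]orbb -mulf_eq0; apply/eqP/h => j _.
  by rewrite mxE -expr2 sqr_ge0.
by move=> /pmulr_lge0 <-; exact: le_trans le_s.
Qed.

Lemma mean_norm2_hist_le k :
  \sum_(h : hist k) hist_weight P G h * norm2 (hist_state h) ^+ 2 <=
  (1 + rate) ^+ k * norm2 v0 ^+ 2.
Proof.
(* From a zero initial state every later state is zero, and both sides vanish. *)
have [v00|v00] := eqVneq v0 0.
  have st0 j (h : hist j) : hist_state h = 0.
    by elim: j h => [|j IH h] //=; rewrite IH mulmx0.
  have norm0 : norm2 (0 : 'cV[R]_n) ^+ 2 = 0 by rewrite norm2_sqr mulmx0 mxE.
  by rewrite v00 norm0 mulr0 big1 // => h _; rewrite st0 norm0 mulr0.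
elim: k => [|k IH].
  rewrite expr0 mul1r (eq_bigr (fun h => hist_weight P G h * norm2 v0 ^+ 2)) //.
  rewrite -mulr_suml ler_piMl ?sqr_ge0 //.
  rewrite (bigD1 tt) //= big1 ?addr0 => [|[]] //.
  by rewrite -lee_fin fineK ?probability_le1 ?fin_num_measure //; exact: (history_measurable Gind).
under eq_bigr do rewrite mulrC.
rewrite (sum_histS (fun h g => norm2 (step g *m hist_state h) ^+ 2)).
rewrite exprS -mulrA; apply: le_trans (ler_wpM2l (one_plus_rate_ge0 v00) IH).
rewrite mulr_sumr; apply: ler_sum => h _; rewrite [leRHS]mulrCA.
by rewrite ler_wpM2l ?hist_weight_ge0 // mean_step_le // ones_hist_state.
Qed.

Lemma hist_state_norm2_anti (w : T) : nonincreasing_seq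
  (fun k => norm2 (hist_state (history G k w)) ^+ 2).
Proof. by apply/nonincreasing_seqP => k /=; exact: norm2_step_le. Qed.

Lemma probability_sup_le (gamma : R) (N : nat) : 0 < gamma ->
  (P [set w | gamma%:E <= ereal_sup [set (norm2 (hist_state (history G k w)) ^+ 2)%:E
                                    | k in [set k : nat | (N <= k)%N]]]
   <= (norm2 v0 ^+ 2 / gamma * (1 + rate) ^+ N)%:E)%E.
Proof.
move=> gamma0.
have -> : [set w | gamma%:E <= ereal_sup [set (norm2 (hist_state (history G k w)) ^+ 2)%:E
      | k in [set k : nat | (N <= k)%N]]]%E =
    history G N @^-1` [set h | gamma <= norm2 (hist_state h) ^+ 2].
  apply/seteqP; split=> w /=.
    move=> le_sup; rewrite -lee_fin; apply: le_trans le_sup _.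
    apply: ge_ereal_sup => _ [k /= Nk <-].
    by rewrite lee_fin; exact: (hist_state_norm2_anti w Nk).
  rewrite -lee_fin => /le_trans; apply; apply: ereal_sup_ubound.
  by exists N => //=.
rewrite (probability_fin_valued P (history_measurable Gind (k := N))) lee_fin.
rewrite mulrAC [norm2 v0 ^+ 2 * _]mulrC ler_pdivlMr //.
apply: le_trans _ (mean_norm2_hist_le N).
(* Markov's inequality on the finite sum: histories in the event have squared norm at least gamma,
   the others contribute nonnegatively. *)
rewrite mulr_suml [leLHS]big_mkcond; apply: ler_sum => h _.
case: ifPn => [/set_mem /= gh|_]; first by rewrite ler_wpM2l ?hist_weight_ge0.
by rewrite mulr_ge0 ?hist_weight_ge0 ?sqr_ge0.
Qed.

Lemma mean_decrease_le k (u : 'cV[R]_n) :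
  \sum_(x : hist k.+1 | hist_state x.1 == u)
     (norm2 (hist_state x) ^+ 2 - norm2 (hist_state x.1) ^+ 2) * hist_weight P G x
  <= rate * norm2 u ^+ 2 * \sum_(x : hist k.+1 | hist_state x.1 == u) hist_weight P G x.
Proof.
rewrite mulr_sumr [leLHS]big_mkcond [leRHS]big_mkcond /=.
(* The restriction to the atom moves into the summand, since [sum_histS] sums over all histories. *)
pose f (h : hist k) (g : simple_graph n) : R := if hist_state h == u then
  norm2 (step g *m hist_state h) ^+ 2 - norm2 (hist_state h) ^+ 2 else 0.
pose f' (h : hist k) (g : simple_graph n) : R :=
  if hist_state h == u then rate * norm2 u ^+ 2 else 0.
rewrite (eq_bigr (fun x : @hist n k.+1 => f x.1 x.2 * hist_weight P G x)); last first.
  by move=> x _; rewrite /f; case: ifP => // _; rewrite mul0r.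
rewrite [leRHS](eq_bigr (fun x : @hist n k.+1 => f' x.1 x.2 * hist_weight P G x)); last first.
  by move=> x _; rewrite /f'; case: ifP => // _; rewrite mul0r.
rewrite !sum_histS; apply: ler_sum => h _; rewrite ler_wpM2l ?hist_weight_ge0 //.
rewrite /f /f'; case: eqP => [<-|_]; last by rewrite !big1 // => g _; rewrite mulr0.
rewrite -mulr_suml sum_graph_weight mul1r.
under eq_bigr do rewrite mulrBr.
rewrite sumrB -mulr_suml sum_graph_weight mul1r lerBlDr.
apply: le_trans (mean_step_le k (ones_hist_state h)) _.
by rewrite mulrDl mul1r addrC.
Qed.

End Consensus.

Theorem theorem4 (R : realType) (d : measure_display) (T : measurableType d)
    (P : probability T R) (n : nat) (hn : (0 < n)%N)
    (p : R) (hp0 : 0 < p) (hp1 : p < 1)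
    (delta : R) (hdelta : delta = 1 / n%:R)
    (z0 : 'cV[R]_n)
    (G : nat -> T -> simple_graph n)
    (hER : forall k : nat, erdos_renyi P p (G k))
    (hind : independent_graphs P G)
    (z : nat -> T -> 'cV[R]_n)
    (hz0 : forall w : T, z 0%N w = z0)
    (hz : forall (k : nat) (w : T),
        z k.+1 w = expm (- (delta *: laplacian R (G k w))) *m z k w)
    (zhat : nat -> T -> 'cV[R]_n)
    (hzhat : forall (k : nat) (w : T), zhat k w = centered (z k w)) :
  (forall (gamma : R) (N : nat), 0 < gamma ->
    (P [set w : T |
          gamma%:E <= ereal_sup [set (norm2 (zhat k w) ^+ 2)%:E
                                | k in [set k : nat | (N <= k)%N]]]
     <= (((centered z0)^T *m centered z0) ord0 ord0 / gamma
          * (1 + n%:R * mu n p) ^+ N)%:E)%E)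
  /\
  (forall k : nat,
    let decrease := fun w : T => lyapunov (zhat k.+1 w) - lyapunov (zhat k w) in
    (exists Y : T -> R, is_cond_exp P (sigma_of (zhat k)) decrease Y) /\
    (forall Y : T -> R, is_cond_exp P (sigma_of (zhat k)) decrease Y ->
      {ae P, forall w : T, Y w <= n%:R * mu n p * norm2 (zhat k w) ^+ 2})).
Proof.
have Jz0 := ones_centered z0 hn.
(* Laplacians vanish on the ones vector, so centering commutes with each step and [zhat] follows the
   same iteration from the centered initial state. *)
have zhatE k : zhat k = @hist_state R n (centered z0) k \o history G k.
  apply/funext => w /=; rewrite hzhat; elim: k => [|k IH] /=; first by rewrite hz0.
  rewrite hz centered_expm ?IH ?hdelta //.
  - by rewrite mulNmx -scalemxAl laplacian_ones scaler0 oppr0.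
  - by rewrite mulmxN -scalemxAr ones_laplacian scaler0 oppr0.
split=> [gamma N gamma0|k decrease].
  rewrite -norm2_sqr.
  have -> : zhat = fun k w => @hist_state R n (centered z0) k (history G k w).
    by apply/funext => k; rewrite zhatE.
  exact: (probability_sup_le hn Jz0 hER hind N gamma0).
(* Both the state at time k and the decrease are read from the history of length k+1, a common
   finite sample space. *)
pose psi (x : @hist n k.+1) := hist_state (centered z0) x.1.
pose phi (x : @hist n k.+1) := norm2 (hist_state (centered z0) x) ^+ 2 - norm2 (psi x) ^+ 2.
have mh := history_measurable hind (k := k.+1).
have -> : zhat k = psi \o history G k.+1 by rewrite zhatE.
have -> : decrease = phi \o history G k.+1.
  apply/funext => w; rewrite /decrease !zhatE.
  by congr (_ - _); apply: lyapunov_norm2 => //; exact: (ones_hist_state Jz0).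
split; first by eexists; exact: is_cond_exp_atom_avg.
move=> Y; apply: (cond_exp_le (g := fun u => n%:R * mu n p * norm2 u ^+ 2) mh).
by move=> u; exact: mean_decrease_le.
Qed.
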